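(* Consider any periodic triangle tiling of the plane and the associated triangle tiling billiard. Let $\delta$ be any periodic trajectory of this billiard and let $\Omega^{\delta}\subset\mathbb{R}^2$ be the domain enclosed by $\delta$. Then the graph $G^{\delta}_{\Delta}:=\Omega^{\delta}\cap\Lambda_{\Delta}$, regarded as a subgraph of $\Lambda_\Delta$, is a tree. In other words, $\delta$ passes by all the tiles that intersect its interior $\Omega^{\delta}$.
   Context: A periodic triangle tiling is a tiling of the Euclidean plane by congruent triangles such that any two tiles sharing a side are centrally symmetric to each other with respect to the midpoint of that side. The triangle tiling billiard on it is the following dynamical system: a point moves along a straight line inside each tile; when it reaches an interior point of an edge it passes to the neighbouring tile across this edge, with refraction according to Snell's law with coefficient $-1$, i.e. the new direction vector is the image of the old one under the reflection that preserves the component normal to the edge and reverses the component tangent to the edge. The piecewise linear curve traced by the point is a trajectory; it is understood to avoid the vertices of the tiling. A trajectory is periodic if it is a closed curve (such a curve is automatically simple); the domain $\Omega^{\delta}$ that a periodic trajectory $\delta$ encloses is the bounded domain with $\partial\Omega^\delta=\delta$. $\Lambda_{\Delta}=(V,E)$ is the graph embedded in the plane whose vertex set $V$ is the set of vertices of all tiles and whose edges $E$ are the sides of the tiles. The subgraph $\Omega^\delta\cap\Lambda_\Delta$ consists of the vertices of $\Lambda_\Delta$ lying in $\Omega^\delta$ and the edges of $\Lambda_\Delta$ contained in $\Omega^\delta$. A trajectory passes by a tile if it crosses the interior of the tile. *)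

(* Defs.v *)
From HB Require Import structures.
From mathcomp Require Import all_boot all_order all_algebra.
From mathcomp Require Import all_classical all_reals all_analysis.

Set Implicit Arguments.
Unset Strict Implicit.
Unset Printing Implicit Defensive.

Import Order.TTheory GRing.Theory Num.Theory.
Import numFieldNormedType.Exports.

Local Open Scope classical_set_scope.
Local Open Scope ring_scope.

(* The library norm on 'rV[R]_2 is the sup norm; it serves only for the
   topology and boundedness.  Metric notions use [dot]. *)
Definition dot {R : realType} (u v : 'rV[R]_2) : R :=
  \sum_(i < 2) u 0 i * v 0 i.

Definition edist {R : realType} (x y : 'rV[R]_2) : R :=
  Num.sqrt (dot (x - y) (x - y)).

Definition congruent {R : realType} (A B : set 'rV[R]_2) : Prop :=
  exists f : 'rV[R]_2 -> 'rV[R]_2,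
    (forall x y, edist (f x) (f y) = edist x y) /\ f @` A = B.

Definition segment {R : realType} (a b : 'rV[R]_2) : set 'rV[R]_2 :=
  [set (1 - s) *: a + s *: b | s in [set s : R | 0 <= s <= 1]].

Definition open_segment {R : realType} (a b : 'rV[R]_2) : set 'rV[R]_2 :=
  [set (1 - s) *: a + s *: b | s in [set s : R | 0 < s < 1]].

Definition midpoint {R : realType} (a b : 'rV[R]_2) : 'rV[R]_2 :=
  2^-1 *: (a + b).

Definition central_symmetry {R : realType} (m x : 'rV[R]_2) : 'rV[R]_2 :=
  2 *: m - x.

Definition boundary {R : realType} (A : set 'rV[R]_2) : set 'rV[R]_2 :=
  closure A `\` A°.

(* A triangle is given by its vertices t : 'I_3 -> 'rV[R]_2; indices are
   added modulo 3. *)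
Definition nondegenerate {R : realType} (t : 'I_3 -> 'rV[R]_2) : Prop :=
  forall a b : R,
    a *: (t 1 - t 0) + b *: (t 2 - t 0) = 0 -> a = 0 /\ b = 0.

Definition triangle {R : realType} (t : 'I_3 -> 'rV[R]_2) : set 'rV[R]_2 :=
  [set \sum_i w i *: t i |
    w in [set w : 'I_3 -> R | (forall i, 0 <= w i) /\ \sum_i w i = 1]].

Definition side {R : realType} (t : 'I_3 -> 'rV[R]_2) (k : 'I_3) :
    set 'rV[R]_2 :=
  segment (t k) (t (k + 1)).

Definition open_side {R : realType} (t : 'I_3 -> 'rV[R]_2) (k : 'I_3) :
    set 'rV[R]_2 :=
  open_segment (t k) (t (k + 1)).

(* A tiling is a family of triangles [tau : I -> 'I_3 -> 'rV[R]_2]; the tile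
   of index i is the closed set [triangle (tau i)].  Disjointness of the
   interiors makes distinct indices denote distinct tiles. *)
Definition triangle_tiling {R : realType} (I : Type)
    (tau : I -> 'I_3 -> 'rV[R]_2) : Prop :=
  [/\ (forall i, nondegenerate (tau i)),
      (forall i j, congruent (triangle (tau i)) (triangle (tau j))),
      (forall x, exists i, triangle (tau i) x)
    & (forall i j, i <> j ->
        (triangle (tau i))° `&` (triangle (tau j))° = set0)].

Definition edge_to_edge {R : realType} (I : Type)
    (tau : I -> 'I_3 -> 'rV[R]_2) : Prop :=
  forall i j, i <> j ->
  [\/ triangle (tau i) `&` triangle (tau j) = set0,
      (exists k l, tau i k = tau j l /\
         triangle (tau i) `&` triangle (tau j) = [set tau i k])
    | (exists k l, side (tau i) k = side (tau j) l /\
         triangle (tau i) `&` triangle (tau j) = side (tau i) k)].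

(* Every edge of the graph of the tiling is meant to separate two neighbouring
   tiles, so the tiling is edge-to-edge.  Without that clause, slid rows of
   triangles would also satisfy the symmetry clause. *)
Definition periodic_triangle_tiling {R : realType} (I : Type)
    (tau : I -> 'I_3 -> 'rV[R]_2) : Prop :=
  [/\ triangle_tiling tau, edge_to_edge tau
    & forall i j k l, i <> j -> side (tau i) k = side (tau j) l ->
        central_symmetry (midpoint (tau i k) (tau i (k + 1)))
          @` triangle (tau i) = triangle (tau j)].

Definition tangent_part {R : realType} (e v : 'rV[R]_2) : 'rV[R]_2 :=
  (dot v e / dot e e) *: e.

Definition normal_part {R : realType} (e v : 'rV[R]_2) : 'rV[R]_2 :=
  v - tangent_part e v.

(* Snell's law with coefficient -1 across an edge of direction e. *)
Definition refract {R : realType} (e v : 'rV[R]_2) : 'rV[R]_2 :=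
  normal_part e v - tangent_part e v.

Definition curve {R : realType} (p : nat -> 'rV[R]_2) : set 'rV[R]_2 :=
  \bigcup_n segment (p n) (p n.+1).

(* The point runs from p n to p n.+1 in direction v n inside the tile c n, and
   crosses at p n.+1 an edge shared by the tiles c n and c n.+1.  The starting
   point p 0 need not lie on an edge, but it does when the trajectory is
   periodic. *)
Definition trajectory {R : realType} (I : Type)
    (tau : I -> 'I_3 -> 'rV[R]_2)
    (c : nat -> I) (p v : nat -> 'rV[R]_2) : Prop :=
  (forall n,
    [/\ exists2 s : R, 0 < s & p n.+1 = p n + s *: v n,
        open_segment (p n) (p n.+1) `<=` (triangle (tau (c n)))°
      & exists k l,
        [/\ c n <> c n.+1, side (tau (c n)) k = side (tau (c n.+1)) l,
            open_side (tau (c n)) k (p n.+1)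
          & v n.+1 = refract (tau (c n) (k + 1) - tau (c n) k) (v n)]])
  /\ (forall i k, ~ curve p (tau i k)).

Definition periodic_trajectory {R : realType} (I : Type)
    (tau : I -> 'I_3 -> 'rV[R]_2)
    (c : nat -> I) (p v : nat -> 'rV[R]_2) : Prop :=
  trajectory tau c p v /\
  exists2 N : nat, (0 < N)%N & forall n, p (n + N)%N = p n.

(* By the Jordan curve theorem, for a simple closed curve delta exactly one
   set Omega satisfies this. *)
Definition enclosed_domain {R : realType} (delta Omega : set 'rV[R]_2) : Prop :=
  [/\ open Omega, connected Omega, Omega !=set0, bounded_set Omega
    & boundary Omega = delta].

(* A simple graph: vertex set V, symmetric irreflexive adjacency e on V.
   [ucycle e s] also holds for s = [:: x; y] with x, y adjacent, which is not
   a cycle of a simple graph. *)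
Definition is_tree (T : eqType) (V : set T) (e : rel T) : Prop :=
  [/\ V !=set0,
      (forall x y, V x -> V y -> exists2 s, path e x s & last x s = y)
    & (forall s, (2 < size s)%N -> ~ ucycle e s)].

Definition tiling_vertex {R : realType} (I : Type)
    (tau : I -> 'I_3 -> 'rV[R]_2) : set 'rV[R]_2 :=
  [set x | exists i k, x = tau i k].

Definition tiling_edge {R : realType} (I : Type)
    (tau : I -> 'I_3 -> 'rV[R]_2) : rel 'rV[R]_2 :=
  fun x y => `[< exists i k l, [/\ k != l, x = tau i k & y = tau i l] >].

Definition subgraph_vertex {R : realType} (I : Type)
    (tau : I -> 'I_3 -> 'rV[R]_2) (Omega : set 'rV[R]_2) : set 'rV[R]_2 :=
  tiling_vertex tau `&` Omega.

Definition subgraph_edge {R : realType} (I : Type)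
    (tau : I -> 'I_3 -> 'rV[R]_2) (Omega : set 'rV[R]_2) : rel 'rV[R]_2 :=
  fun x y => tiling_edge tau x y && `[< segment x y `<=` Omega >].

Definition passes_by {R : realType} (delta A : set 'rV[R]_2) : Prop :=
  (delta `&` A°) !=set0.

(* Main.v *)
From mathcomp Require Import all_boot all_order all_algebra.
From mathcomp Require Import all_classical all_reals all_analysis.
From mathcomp Require Import zify ring lra.
Require Import Defs.

(** Fold a periodic triangle tiling along its edges: all the tiles become
    triangles inscribed in one circle, and a refracted trajectory becomes a
    segment of one chord of this circle, run back and forth.  So the signed
    distance to the chord, read off at the vertices of the tiles that the
    trajectory crosses, is given by one function of the vertex: at the lattice
    point [o + m a + n b] it is [K cos (th + m a1 - n a3) + D], where [a1], [a2],
    [a3] are the central angles of the sides of a tile, of sum [2 pi]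
    ([lattice_tiling], [central_angles], [wave_reflect], [snell_height],
    [height_wave]).  Interpolate this function affinely over the tiles; the curve
    lies in its zero set.  The vertices where it is nonnegative are those whose
    angle lies in an arc of the circle, and the others are those whose angle lies
    in the complementary arc ([wave_arc]).

    Let [W] be the finite set of the vertices inside the curve.  All along the
    curve the domain lies on the same side, which may be taken to be the positive
    one ([inner_step], [outer_side]), so every edge that leaves [W] goes from a
    positive vertex to a negative one.

    The heart of the proof is that a finite set of vertices, closed under
    adjacency among the vertices whose angle lies in a given arc, has fewer edges
    than vertices ([fewer_edgesP], [arc_deg_sum]).  Lift the angles to heights in an
    interval [[lo, hi]]: the edge [e_i] raises the height by [a_i].  Let [a1] be
    the smallest step and remove the points of height above [hi - a1].  Such a
    point is isolated, or its edges are the edge to [t - a1] and edges that can be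
    slid along it; there remains a system of the same kind, with the vectors [e1],
    [e2 - e1], [e3 - e1] and the steps [a1], [a2 - a1], [a3 - a1], in a shorter
    interval.  The difference between the numbers of vertices and edges can only
    have decreased, and the highest point has disappeared, so that an induction on
    the number of points applies.  This is the Rauzy induction of systems of three
    isometries of an interval.

    Consequently a finite component of vertices of one sign is a tree
    ([grown_of_deg]), and the vertices that are adjacent to a tree but not in it
    form a connected graph ([outer_connected]).  If [W] contained a negative
    vertex, its negative component [Q] would be a tree whose outer neighbours lie
    in one positive component [P]; [P] would be a tree whose outer neighbours lie
    in one negative component, which is [Q]; so the finite set formed by [P] and
    [Q] would have no outer neighbour at all, which is absurd ([no_hole]).  Thus
    all of [W] is positive, and has no cycle ([no_cycle]).

    A tile that meets the domain but is not crossed by the curve would have its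
    three vertices in [W], and these form a cycle ([tile_passed]).  So all the
    tiles that meet the domain are crossed, and the part of the domain in such a
    tile is the positive part of the tile, which contains one vertex or two
    adjacent ones.  Hence a partition of [W] without edges between its parts would
    disconnect the domain ([inside_connected]). *)

Set Implicit Arguments.
Unset Strict Implicit.
Unset Printing Implicit Defensive.

Import Order.TTheory GRing.Theory Num.Theory.
Import numFieldNormedType.Exports.

Local Open Scope ring_scope.

(** * Systems of translations of an interval *)

Notation lat := (int * int)%type.

Definition ldet (u w : lat) : int := u.1 * w.2 - u.2 * w.1.

Lemma ldetDl x u w : ldet (x + u) w = ldet x w + ldet u w.
Proof. by rewrite /ldet /=; ring. Qed.

Lemma ex_max (d : Order.disp_t) (T : orderType d) (X : eqType) (f : X -> T)
    (P : seq X) x0 :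
  x0 \in P -> exists2 x, x \in P & forall y, y \in P -> (f y <= f x)%O.
Proof.
elim: P x0 => // z P IH x0 _.
case: P IH => [_|y P IH]; first by exists z; rewrite ?mem_head // => y; rewrite inE => /eqP ->.
have [x xP xmax] := IH y (mem_head _ _).
case: (leP (f x) (f z)) => h.
- exists z; first exact: mem_head.
  move=> w; rewrite inE => /predU1P[->//|/xmax hw]; exact: le_trans hw h.
- exists x; first by rewrite inE xP orbT.
  by move=> w; rewrite inE => /predU1P[->|/xmax//]; apply: ltW.
Qed.

Lemma no_drift (X : eqType) (f : X -> int) (P : seq X) x0 :
  x0 \in P -> (forall x, x \in P -> exists2 y, y \in P & f x < f y) -> False.
Proof.
move=> /(ex_max f)[x xP xmax] /(_ x xP)[y /xmax]; lia.
Qed.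

Section Moves.
Variable R : realFieldType.
Implicit Types (P : seq lat) (t : lat -> R) (lo hi a : R) (u : lat).

(** A finite set that is a union of components of the graph in which [x] and
    [x + u] are joined when the height [t] passes from [t x] to [t x + a]
    without leaving [[lo, hi]]. *)
Definition move_closed P t lo hi a u := forall x, x \in P ->
  (t x + a <= hi -> x + u \in P /\ t (x + u) = t x + a) /\
  (lo <= t x - a -> x - u \in P /\ t (x - u) = t x - a).

Lemma move_up P t lo hi a u x : move_closed P t lo hi a u -> x \in P ->
  t x + a <= hi -> x + u \in P /\ t (x + u) = t x + a.
Proof. by move=> c xP; have [] := c x xP. Qed.

Lemma move_dn P t lo hi a u x : move_closed P t lo hi a u -> x \in P ->
  lo <= t x - a -> x - u \in P /\ t (x - u) = t x - a.
Proof. by move=> c xP; have [] := c x xP. Qed.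

(** In an interval of length at least [a + b] one of the moves [+ a] and [- b]
    is always possible; along them the linear form that vanishes on [u + w]
    increases, so the set is infinite. *)
Lemma move_closed_drift P t lo hi a b u w x0 : x0 \in P ->
  (forall x, x \in P -> lo <= t x <= hi) ->
  move_closed P t lo hi a u -> move_closed P t lo hi b w ->
  0 < ldet u w -> a + b <= hi - lo -> False.
Proof.
move=> x0P tP cu cw uw ab.
apply: (@no_drift _ (fun x => ldet x (u + w)) _ _ x0P) => x xP.
have /andP[h1 h2] := tP x xP.
case: (leP (t x + a) hi) => h.
- have [uP _] := move_up cu xP h; exists (x + u) => //.
  move: uw; rewrite /ldet /=; lia.
- have [|wP _] := move_dn cw xP; first by lra.
  exists (x - w) => //; move: uw; rewrite /ldet /=; lia.
Qed.

Definition ecount P t hi a := count (fun x => t x + a <= hi) P.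

(** The determinants are positive so that no direction ever vanishes in the
    induction; the three directions need not be those of the triangular
    lattice. *)
Definition fewer_edges n := forall P t lo hi a1 a2 a3 u1 u2 u3,
  (size P < n)%N -> uniq P -> P != [::] ->
  0 <= a1 -> 0 <= a2 -> 0 <= a3 ->
  0 < ldet u1 u2 -> 0 < ldet u2 u3 -> 0 < ldet u3 u1 ->
  (forall x, x \in P -> lo <= t x <= hi) ->
  move_closed P t lo hi a1 u1 -> move_closed P t lo hi a2 u2 ->
  move_closed P t lo hi a3 u3 ->
  (ecount P t hi a1 + ecount P t hi a2 + ecount P t hi a3 < size P)%N.

(** One step of the induction, when [a1] is the smallest of the three steps:
    the points above [hi - a1] are deleted and their edges are slid down by
    [a1]. *)
Lemma fewer_edges_step P t lo hi a1 a2 a3 u1 u2 u3 :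
  fewer_edges (size P) -> uniq P -> P != [::] ->
  0 <= a1 -> a1 <= a2 -> a1 <= a3 ->
  0 < ldet u1 u2 -> 0 < ldet u2 u3 -> 0 < ldet u3 u1 ->
  (forall x, x \in P -> lo <= t x <= hi) ->
  move_closed P t lo hi a1 u1 -> move_closed P t lo hi a2 u2 ->
  move_closed P t lo hi a3 u3 ->
  (ecount P t hi a1 + ecount P t hi a2 + ecount P t hi a3 < size P)%N.
Proof.
move=> IH uP Pn0 a1ge a12 a13 d12 d23 d31 tP c1 c2 c3.
have [x0 x0P] : exists x0, x0 \in P.
  by case: (P) Pn0 => // y s _; exists y; rewrite mem_head.
have [/eqP a10|a1n0] := boolP (a1 == 0).
  (* a move of height 0 is always possible, and its direction is not 0 *)
  exfalso; apply: (@no_drift _ (fun x => ldet x u2) _ _ x0P) => x xP.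
  have [|xu _] := move_up c1 xP; first by have := tP x xP; lra.
  by exists (x + u1) => //; rewrite ldetDl; lia.
have a1gt : 0 < a1 by rewrite lt_def a1n0.
pose q := fun x => t x + a1 <= hi.
pose P' := [seq x <- P | q x].
have [xm xmP xmax] := ex_max t x0P.
have szP : (size P' + count (predC q) P = size P)%N.
  by rewrite size_filter count_predC.
have xmq : ~~ q xm.
  apply/negP=> h; have [xuP e] := move_up c1 xmP h.
  by have := xmax _ xuP; rewrite e; lra.
have szlt : (size P' < size P)%N.
  rewrite -szP -[X in (X < _)%N]addn0 ltn_add2l -has_count.
  by apply/hasP; exists xm.
have E1 : ecount P t hi a1 = size P' by rewrite size_filter.
have memP' x : (x \in P') = (q x) && (x \in P) by rewrite mem_filter.
have E2 : ecount P t hi a2 = ecount P' t (hi - a1) (a2 - a1).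
  rewrite /ecount count_filter; apply: eq_count => x /=; rewrite /q; lra.
have E3 : ecount P t hi a3 = ecount P' t (hi - a1) (a3 - a1).
  rewrite /ecount count_filter; apply: eq_count => x /=; rewrite /q; lra.
(* the edges in direction [u1] that the deletion destroys end at distinct
   deleted points *)
have E1' : (size P' <= ecount P' t (hi - a1) a1 + count (predC q) P)%N.
  rewrite -(count_predC (fun x => t x + a1 <= hi - a1) P') leq_add2l.
  rewrite -!size_filter -(size_map (fun x => x + u1)).
  apply: uniq_leq_size.
    rewrite map_inj_uniq; first by rewrite !filter_uniq.
    by move=> x y /addIr.
  move=> y /mapP[x]; rewrite mem_filter memP' /q /= => /and3P[h1 h2 xP] ->.
  have [xuP e] := move_up c1 xP h2.
  by rewrite mem_filter /= xuP andbT e; lra.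
have [P'0|P'n0] := eqVneq P' [::].
  rewrite E1 E2 E3 P'0 /= /ecount /= !addn0.
  by case: (P) Pn0.
have mc b w : a1 <= b -> move_closed P t lo hi b w ->
    move_closed P' t lo (hi - a1) (b - a1) (w - u1).
  move=> a1b cw x; rewrite memP' /q => /andP[qx xP]; split.
    move=> h; have [|xwP e] := move_up cw xP; first by lra.
    have [|xwuP e'] := move_dn c1 xwP.
      by rewrite e; have := tP x xP; lra.
    rewrite addrA memP' /q e' e xwuP; split; last by ring.
    by rewrite andbT; lra.
  move=> h; have [xuP e] := move_up c1 xP qx.
  have [|xuwP e'] := move_dn cw xuP; first by rewrite e; lra.
  have -> : x - (w - u1) = x + u1 - w by rewrite opprB addrA addrAC.
  rewrite memP' /q e' e xuwP; split; last by ring.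
  by rewrite andbT; lra.
have : (ecount P' t (hi - a1) a1 + ecount P' t (hi - a1) (a2 - a1) +
    ecount P' t (hi - a1) (a3 - a1) < size P')%N.
  apply: (IH P' t lo (hi - a1) a1 (a2 - a1) (a3 - a1) u1 (u2 - u1) (u3 - u1))
    => //; first exact: filter_uniq.
  - by lra.
  - by lra.
  - by rewrite (_ : ldet _ _ = ldet u1 u2) // /ldet /=; ring.
  - rewrite (_ : ldet _ _ = ldet u2 u3 + ldet u1 u2 + ldet u3 u1).
      by apply: addr_gt0 => //; apply: addr_gt0.
    by rewrite /ldet /=; ring.
  - by rewrite (_ : ldet _ _ = ldet u3 u1) // /ldet /=; ring.
  - by move=> x; rewrite memP' /q => /andP[? /tP]; lra.
  - move=> x; rewrite memP' /q => /andP[qx xP]; split.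
      move=> h; have [xuP e] := move_up c1 xP qx.
      by rewrite memP' /q xuP e andbT; split; lra.
    move=> h; have [xuP e] := move_dn c1 xP h.
    by rewrite memP' /q xuP e andbT; split; lra.
  - exact: mc.
  - exact: mc.
move=> lt; rewrite E1 E2 E3 -szP -addnA ltn_add2l.
rewrite -(ltn_add2l (ecount P' t (hi - a1) a1)) addnA; exact: leq_trans lt E1'.
Qed.

Lemma edges_ltP n : fewer_edges n.
Proof.
elim: n => // n IH P t lo hi a1 a2 a3 u1 u2 u3 szP uP Pn0 p1 p2 p3
  d12 d23 d31 tP c1 c2 c3.
have IH' : fewer_edges (size P).
  move=> Q t' lo' hi' b1 b2 b3 w1 w2 w3 sz; apply: IH; lia.
have [a12|/ltW a21] := leP a1 a2.
  have [a13|/ltW a31] := leP a1 a3.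
    exact: (fewer_edges_step IH' uP Pn0 p1 a12 a13 d12 d23 d31 tP c1 c2 c3).
  have := fewer_edges_step IH' uP Pn0 p3 a31 (le_trans a31 a12) d31 d12 d23 tP
    c3 c1 c2; lia.
have [a23|/ltW a32] := leP a2 a3.
  have := fewer_edges_step IH' uP Pn0 p2 a23 a21 d23 d31 d12 tP c2 c3 c1; lia.
have := fewer_edges_step IH' uP Pn0 p3 (le_trans a32 a21) a32 d31 d12 d23 tP
  c3 c1 c2; lia.
Qed.
End Moves.

(** * Arcs of the circle on the triangular lattice *)

Definition e1 : lat := (1, 0).
Definition e2 : lat := (-1, 1).
Definition e3 : lat := (0, -1).

Definition nbrs : seq lat := [:: e1; - e3; e2; - e1; e3; - e2].

Definition adj (x y : lat) := y - x \in nbrs.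

Lemma nbrsN u : (- u \in nbrs) = (u \in nbrs).
Proof.
suff h w : w \in nbrs -> - w \in nbrs.
  by apply/idP/idP => [/h|/h//]; rewrite opprK.
by rewrite !inE => /or4P[/eqP->|/eqP->|/eqP->|/or3P[/eqP->|/eqP->|/eqP->]].
Qed.

Lemma adjC x y : adj x y = adj y x.
Proof. by rewrite /adj -nbrsN opprB. Qed.

Lemma adjD x u : adj x (x + u) = (u \in nbrs).
Proof. by rewrite /adj addrC addKr. Qed.

Lemma adj_irr x : adj x x = false.
Proof. by rewrite /adj subrr. Qed.

Definition deg (P : seq lat) (x : lat) := count (fun u => x + u \in P) nbrs.

Definition closed_in (X : lat -> Prop) (S : lat -> Prop) :=
  forall x y, X x -> X y -> adj x y -> S x -> S y.

Lemma count_shift (P : seq lat) (u : lat) : uniq P ->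
  (count (fun x => (x - u)%R \in P) P <= count (fun x => (x + u)%R \in P) P)%N.
Proof.
move=> uP; rewrite -!size_filter -(size_map (fun x => x - u)).
apply: uniq_leq_size.
  by rewrite map_inj_uniq ?filter_uniq // => x y /addIr.
move=> y /mapP[x]; rewrite mem_filter => /andP[xu xP] ->.
by rewrite mem_filter xu subrK xP.
Qed.

Section Arcs.
Variable R : realFieldType.
Implicit Types (P : seq lat) (a : R) (u x : lat).
Variables (t : lat -> R) (lo a1 a2 a3 : R).

(** [t] is the representative in [[lo, lo + a1 + a2 + a3)] of an angle that
    increases by [a_i] along [e_i]: adding a step either stays in this period
    or overflows it exactly once. *)
Definition angle_lift :=
  let T := a1 + a2 + a3 in
  let step u a := forall x, t (x + u) = t x + a \/ t (x + u) = t x + a - T in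
  [/\ 0 < a1, 0 < a2 & 0 < a3] /\
  (forall x, lo <= t x < lo + T) /\ [/\ step e1 a1, step e2 a2 & step e3 a3].

(** A finite set allows no drift, so its heights span less than the sum of any
    two steps, whereas an edge that overflows the period changes the height by
    such a sum.  All the edges are thus moves of the system of translations.
    The count is doubled because every edge is seen from both ends. *)
Lemma arc_deg_sum (J : pred R) P :
  angle_lift -> (forall y z w, J y -> J z -> y <= w <= z -> J w) ->
  uniq P -> P != [::] -> {in P, forall x, J (t x)} ->
  (forall x y, x \in P -> adj x y -> J (t y) -> y \in P) ->
  (\sum_(x <- P) deg P x < (size P).*2)%N.
Proof.
move=> [[a1p a2p a3p] [tb [s1 s2 s3]]] Jconv uP Pn0 PJ Pcl.
have [x0 x0P] : exists x0, x0 \in P.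
  by case: (P) Pn0 => // y s _; exists y; rewrite mem_head.
have [xM MP xmax] := ex_max t x0P.
have [xm mP xmin'] := ex_max (fun x => - t x) x0P.
have xmin y : y \in P -> t xm <= t y by move/xmin'; rewrite lerN2.
have tP x : x \in P -> t xm <= t x <= t xM by move=> xP; rewrite xmin ?xmax.
have mc u a : 0 < a -> u \in nbrs ->
    (forall x, t (x + u) = t x + a \/ t (x + u) = t x + a - (a1 + a2 + a3)) ->
    move_closed P t (t xm) (t xM) a u.
  move=> ap uN st x xP; split=> h.
    have e : t (x + u) = t x + a.
      have [//|e] := st x; have := tb xM; have := tb (x + u); lra.
    split=> //; apply: (Pcl x) => //; first by rewrite adjD.
    apply: (Jconv (t xm) (t xM)); [exact: PJ|exact: PJ|].
    by have := xmin x xP; lra.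
  have e : t (x - u) = t x - a.
    have := st (x - u); rewrite subrK => -[|] e; first by lra.
    have := tb xm; have := tb (x - u); lra.
  split=> //; apply: (Pcl x) => //; first by rewrite adjD nbrsN.
  apply: (Jconv (t xm) (t xM)); [exact: PJ|exact: PJ|].
  by have := xmax x xP; lra.
have m1 := mc e1 a1 a1p isT s1; have m2 := mc e2 a2 a2p isT s2.
have m3 := mc e3 a3 a3p isT s3.
have g12 := move_closed_drift x0P tP m1 m2 isT.
have g23 := move_closed_drift x0P tP m2 m3 isT.
have g31 := move_closed_drift x0P tP m3 m1 isT.
have ec u a b c : 0 < a -> 0 < b -> 0 < c -> a + b + c = a1 + a2 + a3 ->
    (b + c <= t xM - t xm -> False) ->
    (forall x, t (x + u) = t x + a \/ t (x + u) = t x + a - (a1 + a2 + a3)) ->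
    (count (fun x => (x + u)%R \in P) P <= ecount P t (t xM) a)%N.
  move=> ap bp cp abc nbc st; rewrite /ecount -!size_filter.
  apply: uniq_leq_size; first exact: filter_uniq.
  move=> x; rewrite !mem_filter => /andP[xuP xP]; rewrite xP andbT.
  case: (st x) => e; first by rewrite -e xmax.
  exfalso; apply: nbc; have := xmin _ xuP; have := xmax _ xP; lra.
have lt := @edges_ltP _ _ P t _ _ a1 a2 a3 e1 e2 e3 (ltnSn _) uP Pn0 (ltW a1p)
  (ltW a2p) (ltW a3p) isT isT isT tP m1 m2 m3.
have c1 := ec e1 a1 a2 a3 a1p a2p a3p erefl g23 s1.
have c2 := ec e2 a2 a3 a1 a2p a3p a1p ltac:(ring) g31 s2.
have c3 := ec e3 a3 a1 a2 a3p a1p a2p ltac:(ring) g12 s3.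
have -> : (\sum_(x <- P) deg P x =
    \sum_(u <- nbrs) count (fun x => (x + u)%R \in P) P)%N.
  under eq_bigr do rewrite /deg -sum1_count big_mkcond.
  rewrite exchange_big; apply: eq_bigr => u _.
  by rewrite -sum1_count [RHS]big_mkcond.
rewrite !big_cons big_nil.
have := count_shift e1 uP; have := count_shift e2 uP.
have := count_shift e3 uP; move: c1 c2 c3 lt; rewrite addn0.
do 3!move: (count (fun x => x + _ \in P) P).
do 3!move: (count (fun x => x - _ \in P) P).
do 3!move: (ecount P t (t xM) _).
by move: (size P); clear; lia.
Qed.

End Arcs.

(** * Finite subtrees of the triangular lattice *)

(** Connectedness as an induction principle: a property that propagates along
    the edges and holds somewhere holds everywhere. *)
Definition connected_in (X : lat -> Prop) := forall S : lat -> Prop,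
  closed_in X S -> (exists2 x, X x & S x) -> forall x, X x -> S x.

(** The finite nonempty sets of lattice points that induce a tree, described
    by successive additions of leaves. *)
Inductive grown : seq lat -> Prop :=
| grown1 x : grown [:: x]
| grownS P x y : grown P -> x \notin P -> y \in P -> adj x y ->
    (forall z, z \in P -> adj x z -> z = y) -> grown (x :: P).

Lemma ex_leaf P : P != [::] -> (\sum_(x <- P) deg P x < (size P).*2)%N ->
  exists2 x, x \in P & (deg P x <= 1)%N.
Proof.
move=> Pn0 lt; apply: contrapT => h.
have : (\sum_(x <- P) 2 <= \sum_(x <- P) deg P x)%N.
  rewrite big_seq [X in (_ <= X)%N]big_seq; apply: leq_sum => x xP.
  by rewrite ltnNge; apply/negP => xl; apply: h; exists x.
rewrite big_const_seq count_predT iter_addn addn0; lia.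
Qed.

Lemma deg_gt0 P x y : y \in P -> adj x y -> (0 < deg P x)%N.
Proof.
move=> yP xy; rewrite -has_count; apply/hasP; exists (y - x) => //.
by rewrite addrC subrK.
Qed.

Lemma deg1_uniq P x y z : (deg P x <= 1)%N -> y \in P -> adj x y ->
  z \in P -> adj x z -> z = y.
Proof.
rewrite /deg -size_filter => le1 yP xy zP xz.
set F := seq.filter _ _ in le1.
have iF w : w \in P -> adj x w -> w - x \in F.
  by move=> wP xw; rewrite mem_filter [x + _]addrC subrK wP.
have := iF y yP xy; have := iF z zP xz.
case: (F) le1 => [|f [|? ?]] // _; rewrite !inE => /eqP h1 /eqP h2.
by apply: (addIr (- x)); rewrite h1 h2.
Qed.

(** There is always a leaf, since the mean degree is less than 2; deleting it
    preserves the connectedness and the inequality. *)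
Lemma grown_of_deg (P : seq lat) : uniq P -> P != [::] -> connected_in (fun x => x \in P) ->
  (\sum_(x <- P) deg P x < (size P).*2)%N ->
  exists2 Q, Q =i P & grown Q.
Proof.
have [n] := ubnP (size P); elim: n P => // n IH P sz uP Pn0 cP lt.
have [x xP xd] := ex_leaf Pn0 lt.
pose P' := rem x P.
have mP' z : (z \in P') = (z != x) && (z \in P) by rewrite mem_rem_uniq // inE.
have szP' : size P = (size P').+1 by rewrite /P' size_rem //; case: (P) xP.
have [P'0|P'n0] := eqVneq P' [::].
  exists [:: x]; last exact: grown1.
  move=> z; rewrite inE; have := mP' z; rewrite P'0 in_nil.
  by case: eqVneq => [->|] //= _ <-.
have [y yP xy] : exists2 y, y \in P & adj x y.
  apply: contrapT => nex.
  have Sx : forall z, z \in P -> z = x.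
    apply: (cP (fun z => z = x)); last by exists x.
    by move=> z w zP wP zw zx; case: nex; exists w; rewrite -?zx.
  by case: (P') P'n0 mP' => // w s _ /(_ w); rewrite mem_head
    => /esym/andP[/eqP wx /Sx].
have yx : y != x by apply: contraTneq xy => ->; rewrite adj_irr.
have uy z : z \in P -> adj x z -> z = y by by move=> zP xz; exact: (deg1_uniq xd yP xy zP xz).
have lt' : (\sum_(z <- P') deg P' z < (size P').*2)%N.
  have d0 := deg_gt0 yP xy.
  suff : ((\sum_(z <- P') deg P' z).+1 <= \sum_(z <- P') deg P z)%N.
    move: lt d0; rewrite (big_rem x xP) -/P' szP' /=.
    do 2!move: (\sum_(z <- P') _)%N.
    by move: (deg P x) (size P') => *; lia.
  have yP' : y \in P' by rewrite mP' yx yP.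
  have le z : (deg P' z <= deg P z)%N.
    by apply: sub_count => u /=; rewrite mP' => /andP[].
  rewrite !(big_rem y yP') /= -addSn leq_add //; last exact: leq_sum.
  have c1 : (0 < count (fun u => (y + u)%R == x) nbrs)%N.
    rewrite -has_count; apply/hasP; exists (x - y); last by rewrite addrC subrK.
    by rewrite -/(adj y x) adjC.
  apply: (@leq_trans (deg P' y + count (fun u => (y + u)%R == x) nbrs)%N).
    by rewrite -addn1 leq_add2l.
  rewrite /deg -count_predUI.
  rewrite [X in (_ + X)%N](_ : _ = 0%N); last first.
    apply/eqP; rewrite -leqn0 leqNgt -has_count; apply/hasP => -[u _ /=].
    by rewrite mP' => /andP[/andP[/negbTE->]].
  rewrite addn0; apply: sub_count => u /= /orP[|/eqP->//].
  by rewrite mP' => /andP[].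
have cP' : connected_in (fun x => x \in P').
  move=> S cS [z0 z0P' Sz0] z zP'.
  pose S' w := if w == x then S y else S w.
  have yP' : y \in P' by rewrite mP' yx yP.
  have : S' z.
    apply: cP; last by move: zP'; rewrite /= mP' => /andP[].
      move=> v w vP wP vw; rewrite /S'.
      case: eqVneq => [vx|vx]; case: eqVneq => [wx|wx] //.
      - by subst v; rewrite (uy w wP vw).
      - subst w; rewrite adjC in vw; rewrite -(uy v vP vw) => Sv; exact: Sv.
      - by apply: cS => //=; rewrite mP' ?vx ?wx.
    exists z0; first by move: z0P'; rewrite /= mP' => /andP[].
    by rewrite /S'; move: z0P'; rewrite /= mP' => /andP[/negbTE-> _].
  by rewrite /S'; move: zP'; rewrite /= mP' => /andP[/negbTE-> _].
have szn : (size P' < n)%N by rewrite -ltnS -szP'.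
have [Q QP gQ] := IH P' szn (rem_uniq _ uP) P'n0 cP' lt'.
exists (x :: Q).
  by move=> z; rewrite inE QP mP'; case: eqVneq => [->|].
apply: (@grownS _ _ y) => //.
- by rewrite QP mP' eqxx.
- by rewrite QP mP' yx.
- by move=> z; rewrite QP mP' => /andP[_ zP]; exact: uy.
Qed.

(** A leaf has only one neighbour, so a cycle avoids it. *)
Lemma grown_acyclic P s : grown P -> {subset s <= P} -> (2 < size s)%N ->
  ~ ucycle adj s.
Proof.
move=> gP; elim: gP s => [x|Q x y _ IH xQ yQ xy uy] s sP sz /andP[cs us].
  by have := uniq_leq_size us sP; rewrite /= leqNgt (ltn_trans _ sz).
have [xs|xs] := boolP (x \in s); last first.
  apply: (IH s) => //; last by rewrite /ucycle cs us.
  move=> z zs; have := sP z zs; rewrite inE => /predU1P[zx|//].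
  by rewrite zx (negbTE xs) in zs.
(* the two neighbours of a leaf on the cycle would coincide *)
have [i p rp] := rot_to xs.
have : ucycle adj (x :: p) by rewrite -rp /ucycle rot_cycle rot_uniq cs.
have sp : {subset x :: p <= x :: Q} by move=> z; rewrite -rp mem_rot => /sP.
have szp : (2 < size (x :: p))%N by rewrite -rp size_rot.
case: p sp szp {rp} => [|a p] // sp szp.
case/lastP: p sp szp => [|p b] // sp szp /andP[].
rewrite /= rcons_path last_rcons => /andP[xa /andP[_ bx]] /andP[xp /andP[ap _]].
have inQ z : z \in a :: rcons p b -> z \in Q.
  move=> zp; have := sp z; rewrite inE zp orbT inE => /(_ isT)/predU1P[zx|//].
  by rewrite -zx zp in xp.
have aQ : a \in Q by apply: inQ; rewrite mem_head.
have bQ : b \in Q by apply: inQ; rewrite inE mem_rcons mem_head orbT.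
move: ap; rewrite (uy a aQ xa) (uy b bQ _) ?mem_rcons ?mem_head //.
by rewrite adjC.
Qed.

Definition outer (P : seq lat) (y : lat) :=
  y \notin P /\ exists2 x, x \in P & adj x y.

(** The six neighbours of a point form a hexagon, which remains connected when
    one of them is removed. *)
Lemma nbr_arc (S : lat -> Prop) x u : u \in nbrs ->
  (forall v w, v \in nbrs -> w \in nbrs -> v != u -> w != u ->
     adj (x + v) (x + w) -> S (x + v) -> S (x + w)) ->
  forall v w, v \in nbrs -> w \in nbrs -> v != u -> w != u ->
     S (x + v) -> S (x + w).
Proof.
move=> uN h.
have ad v w : adj (x + v) (x + w) = adj v w.
  by rewrite /adj opprD addrACA subrr add0r.
have hh v w : v \in nbrs -> w \in nbrs -> v != u -> w != u -> adj v w ->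
    S (x + v) <-> S (x + w).
  by move=> vN wN vu wu vw; split; apply: h; rewrite ?ad // adjC.
have p1 := hh e1 (- e3) isT isT; have p2 := hh (- e3) e2 isT isT.
have p3 := hh e2 (- e1) isT isT; have p4 := hh (- e1) e3 isT isT.
have p5 := hh e3 (- e2) isT isT; have p6 := hh (- e2) e1 isT isT.
move: uN p1 p2 p3 p4 p5 p6 {hh h}.
rewrite !inE => /or4P[/eqP->|/eqP->|/eqP->|/or3P[/eqP->|/eqP->|/eqP->]];
  move=> p1 p2 p3 p4 p5 p6 v w;
  try (have {}p1 := p1 isT isT isT); try (have {}p2 := p2 isT isT isT);
  try (have {}p3 := p3 isT isT isT); try (have {}p4 := p4 isT isT isT);
  try (have {}p5 := p5 isT isT isT); try (have {}p6 := p6 isT isT isT);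
  rewrite !inE => /or4P[/eqP->|/eqP->|/eqP->|/or3P[/eqP->|/eqP->|/eqP->]];
  rewrite ?eqxx //;
  move=> /or4P[/eqP->|/eqP->|/eqP->|/or3P[/eqP->|/eqP->|/eqP->]];
  rewrite ?eqxx // => _ _; tauto.
Qed.

(** When a leaf [x] is attached at [y], it disappears from the outer boundary
    and its five neighbours other than [y] come in; these form a path, which
    replaces the passages through [x]. *)
Lemma outer_connected P : grown P -> connected_in (outer P).
Proof.
elim=> {P} [x|Q x y _ IH xQ yQ xy uy] S cS [z0 [z0P [w0 w0P w0z0]] Sz0].
  have o u : u \in nbrs -> outer [:: x] (x + u).
    move=> uN; split; last by exists x; rewrite ?mem_head ?adjD.
    rewrite inE; apply: contraTneq uN => /(canRL (addKr _)); rewrite addNr => ->.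
    by [].
  have cS' v w : v \in nbrs -> w \in nbrs -> adj (x + v) (x + w) ->
      S (x + v) -> S (x + w).
    by move=> vN wN vw; apply: cS => //; exact: o.
  have all_nbr v w : v \in nbrs -> w \in nbrs -> S (x + v) -> S (x + w).
    move=> vN wN Sv.
    pose b (c : lat) := (c != v) && (c != w).
    have [u uN /andP[uv uw]] : exists2 u, u \in nbrs & b u.
      have : has b nbrs.
        move: vN wN; rewrite /b !inE.
        by move=> /or4P[/eqP->|/eqP->|/eqP->|/or3P[/eqP->|/eqP->|/eqP->]]
          /or4P[/eqP->|/eqP->|/eqP->|/or3P[/eqP->|/eqP->|/eqP->]].
      by case/hasP => u; exists u.
    apply: (nbr_arc uN _ vN wN _ _ Sv); rewrite 1?eq_sym //.
    by move=> ? ? h1 h2 _ _; exact: cS'.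
  move: w0P w0z0; rewrite inE => /eqP-> xz0 z [_ [w]]; rewrite inE => /eqP-> xz.
  have := all_nbr _ _ xz0 xz; rewrite ![x + _]addrC !subrK; exact.
have yx : y != x by apply: contraTneq xy => ->; rewrite adj_irr.
pose u := y - x; have yE : y = x + u by rewrite addrC subrK.
have uN : u \in nbrs by [].
have o v : v \in nbrs -> v != u -> outer (x :: Q) (x + v).
  move=> vN vu; split; last by exists x; rewrite ?mem_head ?adjD.
  rewrite inE negb_or; apply/andP; split.
    apply: contraTneq vN => /(canRL (addKr _)); rewrite addNr => ->.
    by [].
  apply/negP => xvQ; have := uy _ xvQ; rewrite adjD yE => /(_ vN)/addrI e.
  by rewrite e eqxx in vu.
have all_nbr v w : v \in nbrs -> w \in nbrs -> v != u -> w != u ->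
    S (x + v) -> S (x + w).
  apply: (nbr_arc uN) => {}v {}w vN wN vu wu vw.
  by apply: cS => //; exact: o.
have oQ z : outer (x :: Q) z -> z != x /\
    (outer Q z \/ exists v, [/\ v \in nbrs, v != u & z = x + v]).
  case; rewrite inE negb_or => /andP[zx zQ] [w]; rewrite inE.
  case/predU1P => [-> xz|wQ wz]; last by split=> //; left; split=> //; exists w.
  split=> //; right; exists (z - x); split=> //; last by rewrite addrC subrK.
  apply: contraNneq zQ => h; rewrite (_ : z = y) //.
  by rewrite yE -h addrC subrK.
have Nu : - u \in nbrs by rewrite nbrsN.
have Nuu : - u != u.
  by move: uN; rewrite !inE => /or4P[/eqP->|/eqP->|/eqP->|/or3P[/eqP->|/eqP->|/eqP->]].
pose S' z := if z == x then S (x - u) else S z.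
have nbrx z : outer Q z -> adj x z -> exists v, [/\ v \in nbrs, v != u & z = x + v].
  move=> [zQ _] xz; exists (z - x); split=> //; last by rewrite addrC subrK.
  apply: contraNneq zQ => h; rewrite (_ : z = y) //.
  by rewrite yE -h addrC subrK.
have all' : forall z, outer Q z -> S' z.
  apply: IH.
    move=> z w oz ow zw; rewrite /S'.
    case: eqVneq => [zx|zx]; case: eqVneq => [wx|wx] //.
    - subst z; have [v [vN vu ->]] := nbrx w ow zw; exact: all_nbr.
    - subst w; rewrite adjC in zw.
      have [v [vN vu ->]] := nbrx z oz zw; exact: all_nbr.
    - apply: cS => //; [move: oz|move: ow] => -[n1 [w1 w1Q w1z]];
        (split; [by rewrite inE negb_or n1 ?zx ?wx|by exists w1; rewrite // inE w1Q orbT]).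
  have := oQ z0 _; case; first by split=> //; exists w0.
  move=> z0x [oz0|[v [vN vu z0E]]].
    by exists z0; rewrite // /S' (negbTE z0x).
  exists x; first by split=> //; exists y; rewrite // adjC.
  by rewrite /S' eqxx; rewrite z0E in Sz0; apply: (all_nbr _ _ _ _ _ _ Sz0).
move=> z oz; have [zx [oz'|[v [vN vu ->]]]] := oQ z oz.
  by have := all' z oz'; rewrite /S' (negbTE zx).
have : S' x by apply: all'; split=> //; exists y; rewrite // adjC.
by rewrite /S' eqxx; apply: all_nbr.
Qed.

(** * Monochromatic components *)

(** The connected component of [y] in the class [X], characterized by the
    induction principle that it satisfies. *)
Definition component (X : lat -> Prop) (y z : lat) :=
  X z /\ forall S : lat -> Prop, closed_in X S -> S y -> S z.

Lemma component_refl (X : lat -> Prop) y : X y -> component X y y.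
Proof. by move=> Xy; split. Qed.

Lemma component_step (X : lat -> Prop) y z w :
  component X y z -> X w -> adj z w -> component X y w.
Proof.
move=> [Xz hz] Xw zw; split=> // S cS Sy.
by apply: (cS z) => //; exact: hz.
Qed.

Lemma component_connected (X : lat -> Prop) y : X y -> connected_in (component X y).
Proof.
move=> Xy S cS [x0 cx0 Sx0].
have iff z : component X y z -> (S z <-> S y).
  move=> cz; have [_ hz] := cz.
  suff [] : component X y z /\ (S z <-> S y) by [].
  apply: (hz (fun z => component X y z /\ (S z <-> S y)));
    last by split=> //; exact: component_refl.
  move=> v w Xv Xw vw [cv e]; have cw := component_step cv Xw vw.
  split=> //; rewrite -e; split; apply: cS => //; by rewrite adjC.
by move=> x cx; apply/iff => //; apply/(iff x0).
Qed.

Lemma component_sub_connected (X Y : lat -> Prop) y0 :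
  connected_in Y -> (forall y, Y y -> X y) -> Y y0 -> forall z, Y z -> component X y0 z.
Proof.
move=> cY YX Yy0 z Yz; apply: (cY (component X y0)) => //.
  move=> v w Yv Yw vw cv; exact: (component_step cv (YX _ Yw) vw).
by exists y0 => //; exact: component_refl (YX _ Yy0).
Qed.

Section NoHole.
Variable R : realFieldType.
Variables (t : lat -> R) (lo a1 a2 a3 hi : R) (W : seq lat).
Hypothesis lift : angle_lift t lo a1 a2 a3.

Definition low x := t x <= hi.
Definition high x := ~~ low x.

Hypothesis Wout : forall x y, x \in W -> adj x y -> y \notin W ->
  low x /\ high y.

Let inW X x := X x /\ x \in W.
Let compW X y := [seq z <- undup W | `[< component X y z >]].

Let compW_grown (J : pred R) (X : lat -> Prop) y :
  (forall y z w, J y -> J z -> y <= w <= z -> J w) -> (forall x, X x <-> J (t x)) ->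
  y \in W -> X y ->
  (forall z, component X y z -> z \in W) ->
  exists2 Q, (forall z, z \in Q <-> component X y z) & grown Q.
Proof.
move=> Jc XJ yW Xy cW.
have memP z : (z \in compW X y) <-> component X y z.
  rewrite mem_filter mem_undup; split; first by case/andP => /asboolP.
  by move=> cz; rewrite cW // andbT; apply/asboolP.
have [||||Q QP gQ] := @grown_of_deg (compW X y).
- by rewrite filter_uniq ?undup_uniq.
- by have /memP := component_refl Xy; case: compW.
- move=> S cS [z0 /memP z0P Sz0] z /memP zP.
  apply: (component_connected Xy) zP; last by exists z0.
  by move=> v w /memP cv /memP cw; exact: cS.
- apply: (arc_deg_sum lift Jc).
  + by rewrite filter_uniq ?undup_uniq.
  + by have /memP := component_refl Xy; case: compW.
  + by move=> z /memP[/XJ].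
  + move=> v w /memP cv vw /XJ Xw; apply/memP; exact: component_step cv Xw vw.
by exists Q => // z; rewrite QP.
Qed.

Let low_comp x : low x -> x \in W -> forall z, component low x z -> z \in W.
Proof.
move=> lx xW z [lz h]; have [] : low z /\ z \in W; last by [].
apply: (h (fun z => low z /\ z \in W)) => // v w lv lw vw [_ vW]; split=> //.
by apply: contraT => wW; have [_] := Wout vW vw wW; rewrite /high lw.
Qed.

Let high_comp x : high x -> x \in W -> forall z, component high x z -> z \in W.
Proof.
move=> lx xW z [lz h]; have [] : high z /\ z \in W; last by [].
apply: (h (fun z => high z /\ z \in W)) => // v w lv lw vw [_ vW]; split=> //.
by apply: contraT => wW; have [lv' _] := Wout vW vw wW; rewrite /high lv' in lv.
Qed.

Let low_grown x : low x -> x \in W ->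
  exists2 Q, (forall z, z \in Q <-> component low x z) & grown Q.
Proof.
move=> lx xW; apply: (compW_grown (J := fun r => r <= hi)) => //.
- by move=> ? ? ?; lra.
- exact: low_comp.
Qed.

Let high_grown x : high x -> x \in W ->
  exists2 Q, (forall z, z \in Q <-> component high x z) & grown Q.
Proof.
move=> lx xW; apply: (compW_grown (J := fun r => ~~ (r <= hi))) => //.
- by move=> ? ? ?; lra.
- exact: high_comp.
Qed.

(** The components of the two classes that face each other would surround each
    other, and form together a finite set without outer neighbour. *)
Lemma no_hole x : x \in W -> low x.
Proof.
move=> xW; apply: contraT => hx; exfalso.
have [Q Qc gQ] := high_grown hx xW.
have QW z : z \in Q -> z \in W by move/Qc; exact: high_comp.
have Qh z : z \in Q -> high z by move/Qc => [].
have outQ z : outer Q z -> low z /\ z \in W.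
  move=> [zQ [v vQ vz]].
  have lz : low z.
    apply: contraNT zQ => hz; apply/Qc; apply: component_step vz => //; exact/Qc.
  split=> //; apply: contraT => zW; have [_] := Wout (QW v vQ) vz zW.
  by rewrite /high lz.
have [x0 ox0] : exists x0, outer Q x0.
  have xQ : x \in Q by apply/Qc; exact: component_refl.
  have [q qQ qmax] := ex_max (fun z : lat => z.1) xQ.
  exists (q + e1); split; last by exists q => //; rewrite adjD.
  by apply/negP => /qmax /=; lia.
have [l0 x0W] := outQ _ ox0.
have [P Pc gP] := low_grown l0 x0W.
have PW z : z \in P -> z \in W by move/Pc; exact: low_comp.
have Pl z : z \in P -> low z by move/Pc => [].
have oQP z : outer Q z -> z \in P.
  move=> oz; apply/Pc; apply: (component_sub_connected (outer_connected gQ)) => //.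
  by move=> y /outQ[].
have outP z : outer P z -> high z.
  move=> [zP [v vP vz]]; apply: contra zP => lz.
  by apply/Pc; apply: component_step vz => //; exact/Pc.
have [q0 q0Q q0x0] : exists2 q0, q0 \in Q & adj q0 x0 by case: ox0.
have oq0 : outer P q0.
  split; last by exists x0; [exact: oQP|rewrite adjC].
  by apply/negP => /Pl; apply/negP; exact: Qh.
have oPQ z : outer P z -> z \in Q.
  move=> oz; apply/Qc.
  have cq : component high q0 z by exact: (component_sub_connected (outer_connected gP)).
  have /Qc[_ h0] := q0Q; case: cq => hz h1; split=> // S cS Sx.
  by apply: h1 => //; exact: h0.
have x0PQ : x0 \in P ++ Q by rewrite mem_cat oQP.
apply: (@no_drift _ (fun z : lat => z.1) _ _ x0PQ) => z zPQ.
exists (z + e1); last by rewrite /=; lia.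
have az : adj z (z + e1) by rewrite adjD.
move: zPQ; rewrite !mem_cat => /orP[zP|zQ].
  have [//|n] := boolP (z + e1 \in P).
  by rewrite oPQ //; split=> //; exists z.
have [|n] := boolP (z + e1 \in Q); first by rewrite orbT.
by rewrite oQP //; split=> //; exists z.
Qed.

Lemma no_cycle s : {subset s <= W} -> (2 < size s)%N -> ~ ucycle adj s.
Proof.
case: s => // x s sW sz us.
have xW : x \in W by apply: sW; rewrite mem_head.
have [P Pc gP] := low_grown (no_hole xW) xW.
apply: (@grown_acyclic P (x :: s)) => //.
have /andP[cs _] := us.
have pth p : path adj x p -> {subset p <= W} -> {subset p <= P}.
  elim/last_ind: p => // p z IH; rewrite rcons_path => /andP[xp pz] pW.
  have sub : {subset p <= P}.
    by apply: IH => // v vp; apply: pW; rewrite mem_rcons inE vp orbT.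
  have zW : z \in W by apply: pW; rewrite mem_rcons mem_head.
  move=> v; rewrite mem_rcons inE => /predU1P[->|]; last exact: sub.
  apply/Pc; apply: component_step pz; last exact: no_hole.
  have := mem_last x p; rewrite inE => /predU1P[->|/sub/Pc//].
  exact: component_refl (no_hole xW).
move=> z zs; apply: (pth (rcons s x)) => //.
  by move=> v; rewrite mem_rcons; exact: sW.
by rewrite mem_rcons.
Qed.

End NoHole.

Local Open Scope classical_set_scope.
Local Open Scope ring_scope.

(** * Barycentric coordinates *)

Lemma I3P (k : 'I_3) : [\/ k = 0, k = 1 | k = 2].
Proof.
case: k => [[|[|[|//]]] h]; [apply: Or31|apply: Or32|apply: Or33]; exact: val_inj.
Qed.

Lemma sum3 (V : nmodType) (F : 'I_3 -> V) : \sum_i F i = F 0 + F 1 + F 2.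
Proof.
rewrite !big_ord_recl big_ord0 addr0 addrA.
by congr (F _ + F _ + F _); apply: val_inj.
Qed.

Lemma I3E : ((1 + 1 = 2 :> 'I_3)%R * (2 + 1 = 0 :> 'I_3)%R *
  (1 + 2 = 0 :> 'I_3)%R * (2 + 2 = 1 :> 'I_3)%R * (0 + 1 = 1 :> 'I_3)%R *
  (0 + 2 = 2 :> 'I_3)%R)%type.
Proof. by do !split; apply: val_inj. Qed.

Section Plane.
Variable R : realType.
Implicit Types (u v w x y z : 'rV[R]_2) (t : 'I_3 -> 'rV[R]_2) (k l : 'I_3).

Lemma rv2P x y : x 0 0 = y 0 0 -> x 0 1 = y 0 1 -> x = y.
Proof.
move=> h0 h1; apply/rowP => j; case: j => [[|[|//]] h].
  by rewrite (_ : Ordinal h = 0) //; exact: val_inj.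
by rewrite (_ : Ordinal h = 1) //; exact: val_inj.
Qed.

Lemma dotE u v : dot u v = u 0 0 * v 0 0 + u 0 1 * v 0 1.
Proof.
by rewrite /dot !big_ord_recl big_ord0 addr0; congr (_ + u 0 _ * v 0 _);
  apply: val_inj.
Qed.

Definition det2 u v : R := u 0 0 * v 0 1 - u 0 1 * v 0 0.

Definition area t := det2 (t 1 - t 0) (t 2 - t 0).

Lemma nondeg_area t : nondegenerate t -> area t != 0.
Proof.
rewrite /Defs.nondegenerate /area; move: (t 1 - t 0) (t 2 - t 0) => u w nd'.
apply/eqP; rewrite /det2 => e.
have [w0 u0] : w 0 0 = 0 /\ - u 0 0 = 0.
  by apply: nd'; apply: rv2P; rewrite !mxE; lra.
have [w1 u1] : w 0 1 = 0 /\ - u 0 1 = 0.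
  by apply: nd'; apply: rv2P; rewrite !mxE; lra.
have [] : (1 : R) = 0 /\ (0 : R) = 0.
  by apply: nd'; apply: rv2P; rewrite !mxE; lra.
by move/eqP; rewrite oner_eq0.
Qed.

(** Barycentric coordinates as quotients of areas. *)
Definition bar t k x := det2 (t (k + 1) - x) (t (k + 2) - x) / area t.

Ltac coords := rewrite /bar /area /det2 ?I3E !mxE.

Lemma bar_sum t x : area t != 0 -> bar t 0 x + bar t 1 x + bar t 2 x = 1.
Proof.
move=> nd; move: (nd); rewrite /bar -!mulrDl => ?; rewrite -[RHS](divff nd).
by congr (_ / _); coords; ring.
Qed.

Lemma bar_comb t x : area t != 0 ->
  x = bar t 0 x *: t 0 + bar t 1 x *: t 1 + bar t 2 x *: t 2.
Proof.
move=> nd; move: (nd); coords => nd'.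
by apply: rv2P; coords; field.
Qed.

Lemma bar_aff t k x y s :
  bar t k ((1 - s) *: x + s *: y) = (1 - s) * bar t k x + s * bar t k y.
Proof. by rewrite /bar !mulrA -mulrDl; congr (_ / _); coords; ring. Qed.

Lemma bar_vertex t k l : area t != 0 -> bar t k (t l) = (k == l)%:R.
Proof.
move=> nd; rewrite /bar.
case: (I3P k) => ->; case: (I3P l) => ->; rewrite ?I3E /=;
 by apply: (canLR (mulfK nd)); coords; ring.
Qed.

Lemma bar_uniq t (w : 'I_3 -> R) x : area t != 0 -> \sum_k w k = 1 ->
  x = \sum_k w k *: t k -> forall k, bar t k x = w k.
Proof.
move=> nd; rewrite !sum3 => s1 -> k.
have w0E : w 0 = 1 - w 1 - w 2 by lra.
have -> : w 0 *: t 0 + w 1 *: t 1 + w 2 *: t 2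
  = t 0 + w 1 *: (t 1 - t 0) + w 2 *: (t 2 - t 0).
  by apply: rv2P; rewrite !mxE w0E; ring.
rewrite /bar; apply: (canLR (mulfK nd)).
by case: (I3P k) => ->; rewrite ?w0E; coords; ring.
Qed.

Lemma triangleP t x : area t != 0 ->
  triangle t x <-> forall k, 0 <= bar t k x.
Proof.
move=> nd; split.
  by move=> [w [w0 w1] wx] k; rewrite (bar_uniq nd w1 (esym wx)).
move=> h; exists (fun k => bar t k x); first by split=> //; rewrite sum3 bar_sum.
by rewrite sum3 -bar_comb.
Qed.

Lemma triangle_vertex t k : area t != 0 -> triangle t (t k).
Proof. by move=> nd; apply/triangleP => // l; rewrite bar_vertex // ler0n. Qed.

Lemma cvx2 (x y : R) s : 0 <= s <= 1 -> 0 <= x -> 0 <= y -> 0 <= (1 - s) * x + s * y.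
Proof. by move=> /andP[? ?] ? ?; apply: addr_ge0; apply: mulr_ge0; lra. Qed.

Lemma triangle_convex t x y s : area t != 0 -> triangle t x -> triangle t y ->
  0 <= s <= 1 -> triangle t ((1 - s) *: x + s *: y).
Proof.
move=> nd /(triangleP _ nd) hx /(triangleP _ nd) hy s01.
by apply/triangleP => // k; rewrite bar_aff cvx2.
Qed.

Lemma coordC (i : 'I_2) : continuous (fun x : 'rV[R]_2 => x 0 i).
Proof. exact: coord_continuous. Qed.

Lemma contB (T : topologicalType) (f g : T -> R) :
  continuous f -> continuous g -> continuous (fun a : T => f a - g a).
Proof. by move=> cf cg a; exact: (cvgB (cf a) (cg a)). Qed.

Lemma contM (T : topologicalType) (f g : T -> R) :
  continuous f -> continuous g -> continuous (fun a : T => f a * g a).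
Proof. by move=> cf cg a; exact: (cvgM (cf a) (cg a)). Qed.

Lemma barC t k : continuous (bar t k).
Proof.
have c y i : continuous (fun x : 'rV[R]_2 => (y - x) 0 i).
  have -> : (fun x : 'rV[R]_2 => (y - x) 0 i) = (fun x => y 0 i - x 0 i).
    by apply/funext => x; rewrite !mxE.
  by apply: contB; [exact: cst_continuous|exact: coordC].
apply: contM; last exact: cst_continuous.
by apply: contB; apply: contM; exact: c.
Qed.

Lemma open_bar t k : open [set x | 0 < bar t k x].
Proof.
by apply: (@open_comp _ _ (bar t k) [set r | 0 < r]) => [x _|];
  [exact: barC|exact: open_gt].
Qed.

Lemma closed_triangle t : area t != 0 -> closed (triangle t).
Proof.
move=> nd.
have -> : triangle t = \bigcap_(k in [set: 'I_3]) (bar t k @^-1` [set r | 0 <= r]).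
  apply/seteqP; split=> x; first by move/(triangleP _ nd) => h k _; exact: h.
  by move=> h; apply/triangleP => // k; exact: h.
apply: closed_bigI => k _; apply: closed_comp; last exact: closed_ge.
by move=> x _; exact: barC.
Qed.

Lemma open_dir (U : set 'rV[R]_2) x d : nbhs x U ->
  exists2 e : R, 0 < e & forall s, 0 <= s < e -> U (x + s *: d).
Proof.
move=> Ux.
have c : (fun s : R => x + s *: d) @ (0 : R) --> x + (0 : R) *: d.
  apply: cvgD; first exact: cvg_cst.
  by apply: cvgZl; exact: cvg_id.
have /c : nbhs (x + (0 : R) *: d) U by rewrite scale0r addr0.
move=> /nbhs_ballP[e /= e0 h]; exists e => // s /andP[s0 se].
by apply: h; rewrite /ball /= sub0r normrN ger0_norm.
Qed.

Lemma bar_interior t x : area t != 0 -> (forall k, 0 < bar t k x) ->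
  (triangle t)° x.
Proof.
move=> nd h.
have o : open ([set x | 0 < bar t 0 x] `&` [set x | 0 < bar t 1 x] `&`
    [set x | 0 < bar t 2 x]) by do ![apply: openI]; exact: open_bar.
apply: (filterS _ (open_nbhs_nbhs (conj o _))); last by split; [split|]; exact: h.
by move=> y [[h0 h1] h2]; apply/triangleP => // k; case: (I3P k) => ->; apply: ltW.
Qed.

Lemma interior_bar t x k : area t != 0 -> (triangle t)° x -> 0 < bar t k x.
Proof.
move=> nd xi; have [e e0 he] := open_dir (x - t k) xi.
have := interior_subset xi => /(triangleP _ nd) /(_ k).
rewrite le_eqVlt => /predU1P[b0|//].
have /he /(triangleP _ nd) /(_ k) : 0 <= e / 2 < e by lra.
have -> : x + (e / 2) *: (x - t k) = (1 - - (e / 2)) *: x + (- (e / 2)) *: t k.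
  by apply: rv2P; rewrite !mxE; ring.
rewrite bar_aff bar_vertex // eqxx -b0 mulr0 add0r mulr1 oppr_ge0; lra.
Qed.

End Plane.

(** * Vertices of triangles and isometries *)

Section Triangles.
Variable R : realType.
Implicit Types (u v w x y z : 'rV[R]_2) (t : 'I_3 -> 'rV[R]_2) (k l : 'I_3).

Lemma bar_aff3 t k (w : 'I_3 -> R) (y : 'I_3 -> 'rV[R]_2) : area t != 0 ->
  \sum_j w j = 1 -> bar t k (\sum_j w j *: y j) = \sum_j w j * bar t k (y j).
Proof.
move=> nd; rewrite !sum3 => s1; have w0E : w 0 = 1 - w 1 - w 2 by lra.
rewrite w0E /bar !mulrA -!mulrDl; congr (_ / _).
by rewrite /det2 !mxE; ring.
Qed.

Lemma bar_le1 t k x : area t != 0 -> triangle t x -> bar t k x <= 1.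
Proof.
move=> nd /(triangleP _ nd) h; have := bar_sum x nd.
by have := h 0; have := h 1; have := h 2; case: (I3P k) => ->; lra.
Qed.

(** A vertex is the only point of its triangle where the corresponding
    barycentric coordinate is 1; this affine function reaches its maximum over
    the second triangle at a vertex of the latter. *)
Lemma triangle_eq_vertex t t' k : area t != 0 -> area t' != 0 ->
  triangle t = triangle t' -> exists l, t k = t' l.
Proof.
move=> nd nd' e.
have [w [w0 w1] wE] : triangle t' (t k) by rewrite -e; exact: triangle_vertex.
have in_t l : triangle t (t' l) by rewrite e; exact: triangle_vertex.
have sum1 : \sum_j w j * bar t k (t' j) = 1.
  by rewrite -bar_aff3 // wE bar_vertex // eqxx.
have [l bl] : exists l, bar t k (t' l) = 1.
  apply: contrapT => nex.
  have lt1 l : 0 < 1 - bar t k (t' l).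
    rewrite subr_gt0 lt_neqAle bar_le1 // andbT.
    by apply/eqP => h; apply: nex; exists l.
  have g0 l : 0 <= w l * (1 - bar t k (t' l)) by rewrite mulr_ge0 // ltW.
  have z l : w l = 0.
    have : w l * (1 - bar t k (t' l)) = 0.
      have := g0 0; have := g0 1; have := g0 2.
      move: sum1 w1; rewrite !sum3.
      by case: (I3P l) => ->; lra.
    by move/eqP; rewrite mulf_eq0 (gt_eqF (lt1 l)) orbF => /eqP.
  by move/eqP: w1; rewrite !sum3 !z !addr0 eq_sym oner_eq0.
exists l; have /(triangleP _ nd) g := in_t l.
rewrite [RHS](bar_comb (t' l) nd); have := bar_sum (t' l) nd.
move: bl (g 0) (g 1) (g 2).
by case: (I3P k) => -> h g0 g1 g2 s; apply: rv2P; rewrite !mxE;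
  do ![rewrite (_ : bar t 0 _ = 0); last by lra
      |rewrite (_ : bar t 1 _ = 0); last by lra
      |rewrite (_ : bar t 2 _ = 0); last by lra]; rewrite h; ring.
Qed.

Lemma vertex_inj t k l : area t != 0 -> t k = t l -> k = l.
Proof.
move=> nd e; have := bar_vertex k l nd; rewrite -e bar_vertex // eqxx.
by case: eqVneq => // _ /eqP; rewrite oner_eq0.
Qed.

Lemma side_bar t k x : area t != 0 -> side t k x -> bar t (k + 2) x = 0.
Proof.
move=> nd [s _ <-]; rewrite bar_aff !bar_vertex //.
by case: (I3P k) => ->; rewrite ?I3E /= !mulr0 addr0.
Qed.

Lemma triangle_near_interior t x (U : set 'rV[R]_2) : area t != 0 ->
  triangle t x -> nbhs x U -> exists2 y, U y & (triangle t)° y.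
Proof.
move=> nd /(triangleP _ nd) h nU.
pose g := 3^-1 *: t 0 + 3^-1 *: t 1 + 3^-1 *: t 2.
have bg k : bar t k g = 3^-1.
  apply: (@bar_uniq _ t (fun=> 3^-1)) => //; rewrite !sum3 //; lra.
have [e e0 he] := open_dir (g - x) nU.
pose s := Num.min (e / 2) (1 / 2).
have [s0 se s1] : [/\ 0 < s, s < e & s < 1].
  by rewrite /s; case: (ltP (e / 2) (1 / 2)) => ?; split; lra.
exists (x + s *: (g - x)); first by apply: he; rewrite ltW.
have -> : x + s *: (g - x) = (1 - s) *: x + s *: g.
  by apply: rv2P; rewrite !mxE; ring.
apply: bar_interior => // k; rewrite bar_aff bg.
by apply: ltr_wpDl; [apply: mulr_ge0; rewrite ?h //|apply: mulr_gt0]; lra.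
Qed.

Lemma dot_ge0 x : 0 <= dot x x.
Proof. by rewrite dotE; apply: addr_ge0; rewrite -expr2 sqr_ge0. Qed.

Lemma dot_eq0 x : dot x x = 0 -> x = 0.
Proof.
rewrite dotE -!expr2 => h.
have h0 := sqr_ge0 (x 0 0); have h1 := sqr_ge0 (x 0 1).
have /eqP : x 0 0 ^+ 2 = 0 by lra.
have /eqP : x 0 1 ^+ 2 = 0 by lra.
by rewrite !expf_eq0 /= => /eqP h2 /eqP h3; apply: rv2P; rewrite ?h2 ?h3 mxE.
Qed.

Lemma dot_coord_lt x (r : R) i : 0 < r -> dot x x < r ^+ 2 -> `|x 0 i| < r.
Proof.
move=> r0; rewrite dotE => h.
rewrite -ltr_sqr ?nnegrE ?normr_ge0 ?(ltW r0) // real_normK ?num_real //.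
have h0 := sqr_ge0 (x 0 0); have h1 := sqr_ge0 (x 0 1).
have : i = 0 \/ i = 1.
  by case: i => [[|[|//]] hi]; [left|right]; exact: val_inj.
by case=> ->; nra.
Qed.

Lemma orthonormal_eq0 u w x : dot u u = 1 -> dot w w = 1 -> dot u w = 0 ->
  dot x u = 0 -> dot x w = 0 -> x = 0.
Proof.
rewrite !dotE => uu ww uw xu xw.
have d2 : (u 0 0 * w 0 1 - u 0 1 * w 0 0) ^+ 2 = 1.
  transitivity ((u 0 0 * u 0 0 + u 0 1 * u 0 1) * (w 0 0 * w 0 0 + w 0 1 * w 0 1)
    - (u 0 0 * w 0 0 + u 0 1 * w 0 1) ^+ 2); first by ring.
  by rewrite uu ww uw; ring.
have d0 : u 0 0 * w 0 1 - u 0 1 * w 0 0 != 0.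
  by apply/eqP => h; move: d2; rewrite h expr0n /= => /esym/eqP; rewrite oner_eq0.
apply: rv2P; rewrite mxE; apply: (mulIf d0); rewrite mul0r.
  transitivity (w 0 1 * (x 0 0 * u 0 0 + x 0 1 * u 0 1)
    - u 0 1 * (x 0 0 * w 0 0 + x 0 1 * w 0 1)); first by ring.
  by rewrite xu xw; ring.
transitivity (u 0 0 * (x 0 0 * w 0 0 + x 0 1 * w 0 1)
    - w 0 0 * (x 0 0 * u 0 0 + x 0 1 * u 0 1)); first by ring.
by rewrite xu xw; ring.
Qed.

Section Isometry.
Variable f : 'rV[R]_2 -> 'rV[R]_2.
Hypothesis fiso : forall x y, edist (f x) (f y) = edist x y.

Lemma iso_dot x y : dot (f x - f y) (f x - f y) = dot (x - y) (x - y).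
Proof.
have := fiso x y; rewrite /edist => /(congr1 (fun r : R => r ^+ 2)).
by rewrite !sqr_sqrtr // dot_ge0.
Qed.

(** An isometry sends the standard frame to an orthonormal frame, and a point
    is determined by its distances to the three points of a frame. *)
Lemma iso_surj y : exists x, f x = y.
Proof.
pose d0 : 'rV[R]_2 := \row_j (j == 0)%:R.
pose d1 : 'rV[R]_2 := \row_j (j == 1)%:R.
pose u := f d0 - f 0; pose w := f d1 - f 0.
pose p := dot (y - f 0) u; pose q := dot (y - f 0) w.
pose x : 'rV[R]_2 := p *: d0 + q *: d1; exists x.
have := iso_dot d0 0; have := iso_dot d1 0; have := iso_dot d0 d1.
have := iso_dot x 0; have := iso_dot x d0; have := iso_dot x d1.
have -> : f x - f d1 = (f x - f 0) - w by rewrite /w opprB addrA subrK.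
have -> : f x - f d0 = (f x - f 0) - u by rewrite /u opprB addrA subrK.
have -> : f d0 - f d1 = u - w by rewrite /u /w opprB addrA subrK.
rewrite -/u -/w.
have -> : f x = f 0 + (f x - f 0) by rewrite addrC subrK.
have -> : dot (x - 0) (x - 0) = p ^+ 2 + q ^+ 2.
  by rewrite dotE !mxE /=; ring.
have -> : dot (x - d0) (x - d0) = (p - 1) ^+ 2 + q ^+ 2.
  by rewrite dotE !mxE /=; ring.
have -> : dot (x - d1) (x - d1) = p ^+ 2 + (q - 1) ^+ 2.
  by rewrite dotE !mxE /=; ring.
have -> : dot (d0 - d1) (d0 - d1) = 2 by rewrite dotE !mxE /=; ring.
have -> : dot (d0 - 0) (d0 - 0) = 1 by rewrite dotE !mxE /=; ring.
have -> : dot (d1 - 0) (d1 - 0) = 1 by rewrite dotE !mxE /=; ring.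
rewrite /p /q; move: (f x - f 0); clear x p q; clearbody u w.
move=> z zw zu z0 uw ww uu.
have -> : z = y - f 0; last by rewrite addrC subrK.
apply/eqP; rewrite -subr_eq0; apply/eqP.
move: zw zu z0 uw ww uu; set Y := y - f 0; rewrite !dotE !mxE => zw zu z0 uw ww uu.
by apply: (@orthonormal_eq0 u w); rewrite dotE ?mxE; lra.
Qed.
End Isometry.
End Triangles.

(** * Local finiteness and the neighbours of a tile *)

Section Neighbour.
Variables (R : realType) (I : Type) (tau : I -> 'I_3 -> 'rV[R]_2).
Hypothesis tiling : triangle_tiling tau.
Hypothesis e2e : edge_to_edge tau.
Implicit Types (i j : I) (k l : 'I_3) (x y z : 'rV[R]_2).

Lemma tile_area i : area (tau i) != 0.
Proof. by have [nd _ _ _] := tiling; exact: nondeg_area. Qed.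

Lemma tile_interior_inj i j x :
  (triangle (tau i))° x -> triangle (tau j) x -> i = j.
Proof.
move=> xi xj; have [_ _ _ dis] := tiling.
have nU : nbhs x (triangle (tau i))°.
  by apply: open_nbhs_nbhs; split=> //; exact: open_interior.
have [y yi yj] := triangle_near_interior (tile_area j) xj nU.
by apply: contrapT => ij; have := dis i j ij; rewrite -subset0 => /(_ y (conj yi yj)).
Qed.

Lemma I2P (a : 'I_2) : a = 0 \/ a = 1.
Proof. by case: a => [[|[|//]] h]; [left|right]; exact: val_inj. Qed.

Lemma ball_rV2 x (e : R) y :
  0 < e -> ball x e y <-> forall a : 'I_2, `|x 0 a - y 0 a| < e.
Proof.
move=> e0; split=> [[_ h] a|h]; first exact: (h 0 a).
by split=> // a b; rewrite (ord1 a); exact: h.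
Qed.

(** All the tiles are images of one of them under isometries, so they contain
    a ball of a common radius and lie within a common distance of its centre. *)
Lemma tile_cores (i0 : I) : exists r B : R, 0 < r /\ forall j, exists c,
  (forall y, ball c r y -> triangle (tau j) y) /\
  (forall y a, triangle (tau j) y -> `|y 0 a - c 0 a| <= B).
Proof.
have [_ cong _ _] := tiling; have nd := tile_area i0.
have [g' _ gi'] := triangle_near_interior nd (triangle_vertex 0 nd)
  (filterT : nbhs (tau i0 0) setT).
have /nbhs_ballP[e /= e0 he] : nbhs g' (triangle (tau i0)) by [].
pose B := \sum_k (`|tau i0 k 0 0 - g' 0 0| + `|tau i0 k 0 1 - g' 0 1|) + 1.
have B0 : 0 < B by rewrite ltr_wpDl // sumr_ge0 // => k _; rewrite addr_ge0.
exists (e / 2), (2 * B); split; first by rewrite divr_gt0.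
move=> j; have [f [fiso fT]] := cong i0 j.
have e20 : 0 < e / 2 by rewrite divr_gt0.
exists (f g'); split=> [y /(ball_rV2 _ _ e20) yb|y a].
  have [x xy] := iso_surj fiso y; rewrite -fT; exists x => //.
  apply: he; apply/(ball_rV2 _ _ e0) => a; rewrite distrC.
  have -> : x 0 a - g' 0 a = (x - g') 0 a by rewrite !mxE.
  apply: dot_coord_lt => //; rewrite -(iso_dot fiso) xy dotE !mxE.
  have h0 := yb 0; have h1 := yb 1; rewrite distrC in h0; rewrite distrC in h1.
  move: h0 h1; rewrite !ltr_norml => /andP[? ?] /andP[? ?]; nra.
rewrite -fT => -[x xT <-].
have -> : f x 0 a - f g' 0 a = (f x - f g') 0 a by rewrite !mxE.
apply/ltW; apply: dot_coord_lt; first by rewrite mulr_gt0.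
rewrite iso_dot // dotE !mxE.
have xB b : `|x 0 b - g' 0 b| < B.
  have [w [w0 w1] <-] := xT.
  have -> : (\sum_i w i *: tau i0 i) 0 b - g' 0 b
      = \sum_i w i * (tau i0 i 0 b - g' 0 b).
    have w0E : w 0 = 1 - w 1 - w 2 by move: w1; rewrite sum3; lra.
    by rewrite !sum3 !mxE w0E; ring.
  rewrite /B -[X in X < _]addr0; apply: ler_ltD => //.
  apply: (le_trans (ler_norm_sum _ _ _)); apply: ler_sum => k _.
  rewrite normrM (ger0_norm (w0 k)).
  have wk : w k <= 1.
    by move: w1; rewrite sum3; have := w0 0; have := w0 1; have := w0 2;
      case: (I3P k) => ->; lra.
  apply: (@le_trans _ _ `|tau i0 k 0 b - g' 0 b|); first exact: ler_piMl.
  by case: (I2P b) => ->; rewrite ?lerDl ?lerDr.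
have := xB 0; have := xB 1; rewrite !ltr_norml => /andP[? ?] /andP[? ?]; nra.
Qed.

(** Take tiles that meet the ray at points tending to [x].  Their centres
    accumulate, and two tiles whose centres are closer than the radius of
    their common ball are equal, so one tile occurs infinitely often; it is
    closed, so it contains [x]. *)
Lemma cover_limit x (d : 'rV[R]_2) :
  (forall s : R, 0 < s -> exists j, triangle (tau j) (x + s *: d)) ->
  exists j, triangle (tau j) x /\
    exists2 s : R, 0 < s & triangle (tau j) (x + s *: d).
Proof.
move=> cov.
pose s (n : nat) : R := n.+1%:R^-1.
have s0 n : 0 < s n by rewrite invr_gt0 ltr0n.
have [J JP] := choice (fun n => cov (s n) (s0 n)).
have [r [B [r0 core]]] := tile_cores (J 0%N).
have [c cP] := choice core.
pose C := `|x 0 0| + `|x 0 1| + `|d 0 0| + `|d 0 1| + B.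
have cK n a : `|c (J n) 0 a| <= C.
  have [_ /(_ _ a (JP n))] := cP (J n); rewrite !mxE => h.
  have s1 : s n <= 1 by rewrite invf_le1 ?ltr0n // ler1n.
  have hs : `|s n * d 0 a| <= `|d 0 a|.
    by rewrite normrM (ger0_norm (ltW (s0 n))) ler_piMl.
  have e : c (J n) 0 a = x 0 a + s n * d 0 a - (x 0 a + s n * d 0 a - c (J n) 0 a).
    by ring.
  rewrite e; apply: (le_trans (ler_normB _ _)); rewrite /C lerD //.
  apply: (le_trans (ler_normD _ _)).
  have := normr_ge0 (x 0 0); have := normr_ge0 (x 0 1).
  have := normr_ge0 (d 0 0); have := normr_ge0 (d 0 1).
  by case: (I2P a) hs => ->; lra.
have cpt : compact [set v : 'rV[R]_2 | forall a, `[- C, C]%classic (v ord0 a)].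
  by apply: (@rV_compact _ _ (fun=> `[- C, C]%classic)) => a; exact: segment_compact.
have KF : ((fun n => c (J n)) @ \oo)
    [set v : 'rV[R]_2 | forall a, `[- C, C]%classic (v ord0 a)].
  exists 0%N => // n _ a /=; rewrite in_itv /=; have := cK n a.
  by rewrite ler_norml.
have [q [_ qcl]] := cpt _ _ KF.
have freq N : exists2 n, (N <= n)%N & ball q (r / 2) (c (J n)).
  have [|//|_ [[n /= Nn <-] nb]] := qcl [set c (J n) | n in [set n | (N <= n)%N]]
    (ball q (r / 2)).
  - by exists N => // n Nn; exists n.
  - by apply: nbhsx_ballx; rewrite divr_gt0.
  - by exists n.
have r20 : 0 < r / 2 by rewrite divr_gt0.
have [n0 _ b0] := freq 0%N.
have same n : ball q (r / 2) (c (J n)) -> J n = J n0.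
  move=> bn; apply: (@tile_interior_inj _ _ (c (J n))); last first.
    have [h _] := cP (J n0); apply: h; apply/(ball_rV2 _ _ r0) => a.
    have e : c (J n0) 0 a - c (J n) 0 a
      = (q 0 a - c (J n) 0 a) - (q 0 a - c (J n0) 0 a) by ring.
    move/(ball_rV2 _ _ r20): b0 => /(_ a) h0.
    move/(ball_rV2 _ _ r20): bn => /(_ a) hn.
    rewrite e; apply: (le_lt_trans (ler_normB _ _)).
    by rewrite [ltRHS]splitr ltrD.
  have [h _] := cP (J n).
  by apply: (filterS h); exact: nbhsx_ballx.
exists (J n0); split; last by exists (s n0).
apply: contrapT => xn.
have o : nbhs x (~` triangle (tau (J n0))).
  apply: open_nbhs_nbhs; split=> //; apply: closed_openC.
  exact: closed_triangle (tile_area _).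
have [e e0 he] := open_dir d o.
have [n nN bn] := freq (Num.bound e^-1).
apply: (he (s n)); last by rewrite -(same n bn).
rewrite ltW //= /s -[e]invrK ltf_pV2 ?posrE ?invr_gt0 ?ltr0n //.
apply: (lt_le_trans (archi_boundP _)); first by rewrite invr_ge0 ltW.
by rewrite ler_nat; apply: leqW.
Qed.

(** Just outside the midpoint of the side there are points of other tiles; by
    local finiteness one of these tiles contains the midpoint, and the tiling
    is edge to edge. *)
Lemma neighbour i k : exists j l, i <> j /\ side (tau i) k = side (tau j) l.
Proof.
have nd := tile_area i; have [_ _ cov _] := tiling.
pose m := (1 - 2^-1) *: tau i k + 2^-1 *: tau i (k + 1).
have bm l : bar (tau i) l m = (1 - 2^-1) * (l == k)%:R + 2^-1 * (l == k + 1)%:R.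
  by rewrite bar_aff !bar_vertex.
have mT : triangle (tau i) m.
  by apply/triangleP => // l; rewrite bm cvx2 ?ler0n //; lra.
have [j [mj [s s0 yj]]] := cover_limit (d := m - tau i (k + 2))
  (fun s _ => cov (m + s *: (m - tau i (k + 2)))).
have ij : i <> j.
  move=> ij; move: yj; rewrite -ij => /(triangleP _ nd) /(_ (k + 2)).
  have -> : m + s *: (m - tau i (k + 2)) = (1 - - s) *: m + (- s) *: tau i (k + 2).
    by apply: rv2P; rewrite !mxE; ring.
  rewrite bar_aff bm bar_vertex // eqxx.
  have -> : (k + 2 == k) = false by case: (I3P k) => ->.
  have -> : (k + 2 == k + 1) = false by case: (I3P k) => ->.
  rewrite !mulr0 addr0 mulr0 add0r mulr1 oppr_ge0; lra.
have mij : (triangle (tau i) `&` triangle (tau j)) m by [].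
exists j; case: (e2e ij) => [e|[k' [l' [_ e]]]|[k' [l' [sE e]]]].
- by rewrite e in mij.
- move: mij; rewrite e /= => me; have := bm k; have := bm (k + 1).
  rewrite me !bar_vertex // !eqxx.
  have -> : (k + 1 == k) = false by case: (I3P k) => ->.
  have -> : (k == k + 1) = false by case: (I3P k) => ->.
  by case: (k + 1 == k'); case: (k == k'); rewrite /=; lra.
- exists l'; suff <- : k' = k by [].
  apply/eqP; apply: contraT => kk'; exfalso.
  move: mij; rewrite e => /(side_bar nd); rewrite bm.
  by move: kk'; case: (I3P k) => ->; case: (I3P k') => -> //=; rewrite ?I3E /=; lra.
Qed.

End Neighbour.

(** * The tiling is a lattice tiling *)

Section Lattice.
Variables (R : realType) (o a b : 'rV[R]_2).
Hypothesis ab0 : 0 < det2 a b.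
Implicit Types (s : bool) (x z : lat) (y : 'rV[R]_2) (k l : 'I_3).

Definition Pt z : 'rV[R]_2 := o + z.1%:~R *: a + z.2%:~R *: b.

Definition cx y : R := det2 (y - o) b / det2 a b.
Definition cy y : R := det2 a (y - o) / det2 a b.

Lemma coordE y : y = o + cx y *: a + cy y *: b.
Proof.
have := gt_eqF ab0; rewrite /cx /cy /det2 => /negbT ab.
by apply: rv2P; rewrite !mxE; field.
Qed.

Lemma cx_comb p q : cx (o + p *: a + q *: b) = p.
Proof.
have := gt_eqF ab0; rewrite /cx /det2 => /negbT ab.
by apply: (canLR (mulfK ab)); rewrite !mxE; ring.
Qed.

Lemma cy_comb p q : cy (o + p *: a + q *: b) = q.
Proof.
have := gt_eqF ab0; rewrite /cy /det2 => /negbT ab.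
by apply: (canLR (mulfK ab)); rewrite !mxE; ring.
Qed.

Lemma cx_Pt z : cx (Pt z) = z.1%:~R. Proof. exact: cx_comb. Qed.
Lemma cy_Pt z : cy (Pt z) = z.2%:~R. Proof. exact: cy_comb. Qed.

Lemma Pt_inj : injective Pt.
Proof.
move=> [m n] [m' n'] e; have := cx_Pt (m, n); have := cy_Pt (m, n).
by rewrite e cx_Pt cy_Pt /= => /intr_inj -> /intr_inj ->.
Qed.

Definition sgl s (u : lat) : lat := if s then u else - u.

Definition off k : lat := if k == 0 then 0 else if k == 1 then e1 else - e3.

(** The lattice triangles: the one with vertices [x], [x + e1], [x - e3] for
    [s = true], and its image under the point reflection in [x] for [s =
    false]. *)
Definition ltile s x k := Pt (x + sgl s (off k)).

Definition lbar s x k y : R :=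
  let sg r := if s then r else - r in
  if k == 0 then 1 - sg (cx y - x.1%:~R) - sg (cy y - x.2%:~R)
  else if k == 1 then sg (cx y - x.1%:~R) else sg (cy y - x.2%:~R).

Lemma ltile_area s x : area (ltile s x) = det2 a b.
Proof.
by case: s; rewrite /area /ltile /Pt /det2 /= !mxE /= !intrD ?intrN; ring.
Qed.

Lemma ltile_area0 s x : area (ltile s x) != 0.
Proof. by rewrite ltile_area gt_eqF. Qed.

Lemma ltile_bar s x k y : bar (ltile s x) k y = lbar s x k y.
Proof.
apply: (bar_uniq (w := fun k => lbar s x k y) (ltile_area0 s x)); rewrite sum3.
  by rewrite /lbar /=; case: s; ring.
rewrite [LHS]coordE /lbar /ltile /Pt; case: s => /=;
  by apply: rv2P; rewrite !mxE /= !intrD ?intrN; ring.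
Qed.

Lemma ltileP s x y : triangle (ltile s x) y <->
  if s then [/\ x.1%:~R <= cx y, x.2%:~R <= cy y & cx y + cy y <= x.1%:~R + x.2%:~R + 1]
  else [/\ cx y <= x.1%:~R, cy y <= x.2%:~R & x.1%:~R + x.2%:~R - 1 <= cx y + cy y].
Proof.
rewrite (triangleP _ (ltile_area0 s x)); split.
  move=> h; have := h 0; have := h 1; have := h 2; rewrite !ltile_bar /lbar /=.
  by case: s {h} => *; split; lra.
case: s => -[h1 h2 h3] k; rewrite ltile_bar /lbar;
  by case: (I3P k) => -> /=; lra.
Qed.

Lemma ltile_cover y : exists s x, triangle (ltile s x) y.
Proof.
pose m := Num.floor (cx y); pose n := Num.floor (cy y).
have /andP[m1 m2] := floor_itv (cx y).
have /andP[n1 n2] := floor_itv (cy y).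
rewrite -/m -/n !intrD in m1 m2 n1 n2.
case: (leP (cx y + cy y) (m%:~R + n%:~R + 1)) => h.
  by exists true, (m, n); apply/ltileP.
exists false, (m + 1, n + 1); apply/ltileP => /=; rewrite !intrD; split; lra.
Qed.

(** The base point of the lattice triangle across the side [l]. *)
Definition flip s x l : lat :=
  x + sgl s (if l == 0 then e1 else if l == 1 then e1 - e3 else - e3).

Lemma ltile_flip s x l :
  central_symmetry (midpoint (ltile s x l) (ltile s x (l + 1)))
    @` triangle (ltile s x) = triangle (ltile (~~ s) (flip s x l)).
Proof.
set m := midpoint _ _.
have cxm y : cx (central_symmetry m y) = cx (ltile s x l) + cx (ltile s x (l + 1)) - cx y.
  rewrite /cx -!mulrDl -mulrBl; congr (_ / _).
  by rewrite /m /midpoint /central_symmetry /det2 !mxE; field.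
have cym y : cy (central_symmetry m y) = cy (ltile s x l) + cy (ltile s x (l + 1)) - cy y.
  rewrite /cy -!mulrDl -mulrBl; congr (_ / _).
  by rewrite /m /midpoint /central_symmetry /det2 !mxE; field.
have inv y : central_symmetry m (central_symmetry m y) = y.
  by rewrite /central_symmetry opprB addrC subrK.
have sub y : triangle (ltile s x) y <->
    triangle (ltile (~~ s) (flip s x l)) (central_symmetry m y).
  rewrite !ltileP cxm cym /flip /ltile !cx_Pt !cy_Pt.
  by case: (s); case: (I3P l) => ->; rewrite ?I3E /= !(intrD, intrN);
    split=> -[h1 h2 h3]; split; lra.
apply/seteqP; split=> y; first by move=> [z /sub h <-].
by rewrite -{1}(inv y) => /sub h; exists (central_symmetry m y).
Qed.

Lemma adj_off s x k l : k != l -> adj (x + sgl s (off k)) (x + sgl s (off l)).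
Proof.
rewrite /adj opprD addrACA subrr add0r.
by case: s; case: (I3P k) => ->; case: (I3P l) => ->.
Qed.

Lemma adj_side z w : adj z w -> exists s x k l,
  [/\ k != l, z = x + sgl s (off k) & w = x + sgl s (off l)].
Proof.
move=> zw; have wE : w = z + (w - z) by rewrite addrC subrK.
move: zw; rewrite wE adjD; move: (w - z) => u {wE}.
rewrite !inE => /or4P[/eqP->|/eqP->|/eqP->|/or3P[/eqP->|/eqP->|/eqP->]].
- by exists true, z, 0, 1; split=> //=; rewrite addr0.
- by exists true, z, 0, 2; split=> //=; rewrite addr0.
- exists true, (z - e1), 1, 2; split=> //=; first by rewrite subrK.
  by rewrite -addrA.
- by exists false, z, 0, 1; split=> //=; rewrite subr0.
- by exists false, z, 0, 2; split=> //=; rewrite ?subr0 ?opprK.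
- exists false, (z + e1), 1, 2; split=> //=; first by rewrite addrK.
  by rewrite -addrA.
Qed.

End Lattice.

Section LatticeTiling.
Variables (R : realType) (I : Type) (tau : I -> 'I_3 -> 'rV[R]_2).
Hypothesis ptau : periodic_triangle_tiling tau.
Implicit Types (s : bool) (x z : lat) (i j : I) (k l : 'I_3).

Let tiling : triangle_tiling tau. Proof. by case: ptau. Qed.

Lemma other_pair k l : k != l -> exists m, (k = m /\ l = m + 1) \/ (k = m + 1 /\ l = m).
Proof.
case: (I3P k) => ->; case: (I3P l) => -> // _;
  by [exists 0; left; rewrite I3E|exists 0; right; rewrite I3E
     |exists 1; left; rewrite I3E|exists 1; right; rewrite I3E
     |exists 2; left; rewrite I3E|exists 2; right; rewrite I3E].
Qed.

Lemma eq_tile_pair (t : 'I_3 -> 'rV[R]_2) i l l' : area t != 0 ->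
  triangle (tau i) = triangle t -> l != l' ->
  exists k, (tau i k = t l /\ tau i (k + 1) = t l')
    \/ (tau i k = t l' /\ tau i (k + 1) = t l).
Proof.
move=> nd e ll'; have ndi := tile_area tiling i.
have [k1 h1] := triangle_eq_vertex l nd ndi (esym e).
have [k2 h2] := triangle_eq_vertex l' nd ndi (esym e).
have kk : k1 != k2.
  by apply: contraNneq ll' => k12; apply/eqP/(vertex_inj nd); rewrite h1 k12.
have [m [[m1 m2]|[m1 m2]]] := other_pair kk; exists m.
  by left; rewrite h1 h2 m1 m2.
by right; rewrite h1 h2 m1 m2.
Qed.

Lemma midpointC (x y : 'rV[R]_2) : midpoint x y = midpoint y x.
Proof. by rewrite /midpoint addrC. Qed.

Section Base.
Variables (o a b : 'rV[R]_2).
Hypothesis ab0 : 0 < det2 a b.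
Hypothesis base : exists i, triangle (tau i) = triangle (ltile o a b true 0).

Let is_tile s x := exists i, triangle (tau i) = triangle (ltile o a b s x).

Lemma is_tile_flip s x l : is_tile s x -> is_tile (~~ s) (flip s x l).
Proof.
move=> [i e].
have ll : l != l + 1 by case: (I3P l) => ->.
have [k kE] := eq_tile_pair (ltile_area0 o ab0 s x) e ll.
have [_ e2e sym] := ptau.
have [j [l' [ij sE]]] := neighbour tiling e2e i k.
exists j; rewrite -(sym i j k l' ij sE) e -ltile_flip //.
by case: kE => -[-> ->] //; rewrite midpointC.
Qed.

(** Passing through two sides translates a lattice tile by any of the two
    basis vectors or their opposites. *)
Lemma is_tile_all s x : is_tile s x.
Proof.
have up z : is_tile true z -> is_tile true (z + e1) /\ is_tile true (z - e1)
   /\ is_tile true (z - e3) /\ is_tile true (z + e3).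
  move=> h.
  have g l l' := is_tile_flip l' (is_tile_flip l h).
  split; [|split; [|split]].
  - by have := g 1 2; rewrite /flip /=; congr is_tile; case: (z) => m n; congr pair => /=; ring.
  - by have := g 2 1; rewrite /flip /=; congr is_tile; case: (z) => m n; congr pair => /=; ring.
  - by have := g 1 0; rewrite /flip /=; congr is_tile; case: (z) => m n; congr pair => /=; ring.
  - by have := g 0 1; rewrite /flip /=; congr is_tile; case: (z) => m n; congr pair => /=; ring.
have h1 (m : int) : is_tile true (m, 0).
  elim/int_rec: m => [|m IH|m IH]; first exact: base.
  - by have [h _] := up _ IH; move: h; congr is_tile; congr pair => /=; lia.
  - by have [_ [h _]] := up _ IH; move: h; congr is_tile; congr pair => /=; lia.
have h2 (m n : int) : is_tile true (m, n).
  elim/int_rec: n => [|n IH|n IH]; first exact: h1.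
  - by have [_ [_ [h _]]] := up _ IH; move: h; congr is_tile; congr pair => /=; lia.
  - by have [_ [_ [_ h]]] := up _ IH; move: h; congr is_tile; congr pair => /=; lia.
case: s; first by case: x.
case: x => m n; have := is_tile_flip 0 (h2 (m - 1) n); rewrite /flip /=.
by congr is_tile; congr pair => /=; lia.
Qed.

Lemma tile_is_ltile i : exists s x, triangle (tau i) = triangle (ltile o a b s x).
Proof.
have nd := tile_area tiling i.
have [y _ yi] := triangle_near_interior nd (triangle_vertex 0 nd)
  (filterT : nbhs (tau i 0) setT).
have [s [x yx]] := ltile_cover o ab0 y.
have [j jE] := is_tile_all s x; exists s, x; rewrite -jE.
by congr (triangle (tau _)); apply: (tile_interior_inj tiling yi); rewrite jE.
Qed.

End Base.

Lemma lattice_tiling : exists o a b : 'rV[R]_2, [/\ 0 < det2 a b,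
  forall s x, exists i, triangle (tau i) = triangle (ltile o a b s x) &
  forall i, exists s x, triangle (tau i) = triangle (ltile o a b s x)].
Proof.
have [_ _ cov _] := tiling; have [i _] := cov 0.
suff : exists o a b : 'rV[R]_2, 0 < det2 a b /\
    triangle (tau i) = triangle (ltile o a b true 0).
  move=> [p0 [a [b [ab0 e]]]].
  have base : exists j, triangle (tau j) = triangle (ltile p0 a b true 0) by exists i.
  exists p0, a, b; split=> //; first exact: is_tile_all.
  exact: tile_is_ltile.
have nd := tile_area tiling i; set t := tau i.
have tE : t 1 = t 0 + (t 1 - t 0) /\ t 2 = t 0 + (t 2 - t 0).
  by rewrite ![t 0 + _]addrC !subrK.
have [pos|neg] := ltP 0 (area t).
  exists (t 0), (t 1 - t 0), (t 2 - t 0); split=> //; congr triangle.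
  apply/funext => k; rewrite /ltile /Pt.
  by case: (I3P k) => -> /=; rewrite !(scale0r, scale1r, addr0) //; case: tE.
exists (t 0), (t 2 - t 0), (t 1 - t 0); split.
  have : area t < 0 by rewrite lt_neqAle nd.
  by rewrite /area /det2; lra.
have opp3 : (- 1 = 2 :> 'I_3) /\ (- 2 = 1 :> 'I_3) by split; exact: val_inj.
have -> : ltile (t 0) (t 2 - t 0) (t 1 - t 0) true 0 = fun k => t (- k).
  apply/funext => k; rewrite /ltile /Pt.
  by case: (I3P k) => -> /=; rewrite ?oppr0 ?opp3.1 ?opp3.2
    !(scale0r, scale1r, addr0) //; case: tE.
have sumN (V : nmodType) (F : 'I_3 -> V) : \sum_k F (- k) = \sum_k F k.
  by rewrite !sum3 oppr0 opp3.1 opp3.2 addrAC.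
apply/seteqP; split=> y [w [w0 w1] <-].
  exists (fun k => w (- k)); first by split=> //; rewrite sumN.
  by rewrite -[RHS]sumN; apply: eq_bigr => k _ /=; rewrite ?opprK.
exists (fun k => w (- k)); first by split=> //; rewrite sumN.
by rewrite -[LHS]sumN; apply: eq_bigr => k _ /=; rewrite ?opprK.
Qed.

End LatticeTiling.

(** * Central angles and waves on the lattice *)

Section Angles.
Variable R : realType.
Implicit Types x y r c s K D th : R.

Lemma cos_lt1 c s : c ^+ 2 + s ^+ 2 = 1 -> s != 0 -> -1 < c < 1.
Proof.
move=> e s0; have s2 : 0 < s ^+ 2 by rewrite exprn_even_gt0.
have c2 : c ^+ 2 < 1 by lra.
by apply/andP; split; nra.
Qed.

Lemma unit_angle_pos c s : c ^+ 2 + s ^+ 2 = 1 -> 0 < s ->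
  exists2 th, 0 < th < pi & cos th = c /\ sin th = s.
Proof.
move=> e s0; have /andP[c1 c2] := cos_lt1 e (lt0r_neq0 s0).
have c11 : -1 <= c <= 1 by rewrite !ltW.
have [_ cth] := acos_def c11.
have th1 : 0 < acos c < pi by rewrite acos_gt0 ?acos_ltpi // ?c1 ?c2 ltW.
exists (acos c) => //; split=> //.
have sp := sin_gt0_pi th1.
apply/eqP; rewrite -(@eqrXn2 _ 2) ?ltW //; apply/eqP.
by rewrite sin2cos2 cth; lra.
Qed.

Lemma unit_angle c s : c ^+ 2 + s ^+ 2 = 1 ->
  exists th, cos th = c /\ sin th = s.
Proof.
move=> e; have [s0|s0|s0] := ltgtP s 0.
- have [||th _ [h1 h2]] := @unit_angle_pos c (- s); rewrite ?sqrrN ?oppr_gt0 //.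
  by exists (- th); rewrite cosN sinN h1 h2 opprK.
- by have [th _ h] := unit_angle_pos e s0; exists th.
have : (c - 1) * (c + 1) = 0 by rewrite s0 in e; nra.
move/eqP; rewrite mulf_eq0 subr_eq0 addr_eq0 => /orP[/eqP->|/eqP->].
  by exists 0; rewrite cos0 sin0 s0.
by exists pi; rewrite cospi sinpi s0.
Qed.

Lemma polar x y : (x, y) != (0, 0) ->
  exists K th, [/\ 0 < K, x = K * cos th & y = K * sin th].
Proof.
move=> xy; pose K := Num.sqrt (x ^+ 2 + y ^+ 2).
have n0 : 0 < x ^+ 2 + y ^+ 2.
  rewrite lt_neqAle addr_ge0 ?sqr_ge0 // andbT eq_sym paddr_eq0 ?sqr_ge0 //.
  by rewrite !sqrf_eq0; move: xy; rewrite xpair_eqE.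
have K0 : 0 < K by rewrite sqrtr_gt0.
have KK : K ^+ 2 = x ^+ 2 + y ^+ 2 by rewrite sqr_sqrtr // ltW.
have [|th [c s]] := @unit_angle (x / K) (y / K).
  by rewrite !expr_div_n -mulrDl -KK divff // sqrf_eq0 gt_eqF.
exists K, th; rewrite c s; split=> //; by rewrite mulrC divfK // gt_eqF.
Qed.

Lemma cos_add2pi x : cos (x + 2 * pi) = cos x.
Proof. by rewrite mulr_natl cosD2pi. Qed.

(** The central angles that the sides of a triangle subtend in its
    circumscribed circle are twice the interior angles.  The [q] are the
    squared side lengths, the [d] the dot products of the sides and [S] is
    twice the area, so that only rational functions of the coordinates appear. *)
Lemma central_angles (q1 q2 q3 d12 d23 d31 S : R) : 0 < q1 -> 0 < q2 -> 0 < q3 ->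
  0 < S -> q1 = - d12 - d31 -> q2 = - d12 - d23 -> q3 = - d23 - d31 ->
  S ^+ 2 = d12 * d23 + d23 * d31 + d31 * d12 ->
  exists a1 a2 a3 : R, [/\ [/\ 0 < a1, 0 < a2 & 0 < a3], a1 + a2 + a3 = 2 * pi,
    cos a1 = 1 - 2 * S ^+ 2 / (q2 * q3) /\ sin a1 = - 2 * S * d23 / (q2 * q3),
    cos a2 = 1 - 2 * S ^+ 2 / (q3 * q1) /\ sin a2 = - 2 * S * d31 / (q3 * q1) &
    cos a3 = 1 - 2 * S ^+ 2 / (q1 * q2) /\ sin a3 = - 2 * S * d12 / (q1 * q2)].
Proof.
move=> q1p q2p q3p Sp q1E q2E q3E SE.
have ex (q : R) : 0 < q -> exists2 r, 0 < r & q = r ^+ 2.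
  by move=> qp; exists (Num.sqrt q); rewrite ?sqrtr_gt0 // sqr_sqrtr // ltW.
have [r1 r1p r1E] := ex _ q1p; have [r2 r2p r2E] := ex _ q2p.
have [r3 r3p r3E] := ex _ q3p.
have [z1 [z2 z3]] : [/\ r1 != 0, r2 != 0 & r3 != 0] by rewrite !gt_eqF.
have [|A1 A1p [c1 s1]] := @unit_angle_pos (- d23 / (r2 * r3)) (S / (r2 * r3)) _
  (divr_gt0 Sp (mulr_gt0 r2p r3p)).
  rewrite !expr_div_n -mulrDl !exprMn -r2E -r3E SE.
  apply: (canLR (mulfK _)); first by rewrite gt_eqF // mulr_gt0.
  by rewrite q2E q3E; ring.
have [|A2 A2p [c2 s2]] := @unit_angle_pos (- d31 / (r3 * r1)) (S / (r3 * r1)) _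
  (divr_gt0 Sp (mulr_gt0 r3p r1p)).
  rewrite !expr_div_n -mulrDl !exprMn -r3E -r1E SE.
  apply: (canLR (mulfK _)); first by rewrite gt_eqF // mulr_gt0.
  by rewrite q3E q1E; ring.
have s12 : sin (A1 + A2) = S / (r1 * r2).
  rewrite sinD c1 s1 c2 s2; transitivity (S * q3 / (r1 * r2 * r3 ^+ 2)).
    by rewrite q3E; field; rewrite z1 z2 z3.
  by rewrite r3E; field; rewrite z1 z2 z3.
have c12 : cos (A1 + A2) = d12 / (r1 * r2).
  rewrite cosD c1 s1 c2 s2.
  transitivity ((d23 * d31 - S ^+ 2) / (r1 * r2 * r3 ^+ 2)).
    by field; rewrite z1 z2 z3.
  rewrite SE; transitivity (d12 * q3 / (r1 * r2 * r3 ^+ 2)).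
    by congr (_ / _); rewrite q3E; ring.
  by rewrite r3E; field; rewrite z1 z2 z3.
have A12 : A1 + A2 < pi.
  rewrite ltNge; apply/negP => h.
  have : 0 <= sin (A1 + A2 - pi) by apply: sin_ge0_pi; lra.
  rewrite sinB cospi sinpi s12 mulr0 subr0 mulrN1 oppr_ge0 leNgt.
  by rewrite divr_gt0 // mulr_gt0.
exists (2 * A1), (2 * A2), (2 * (pi - (A1 + A2))).
rewrite !mulr_natl !cos_mulr2n !sin_mulr2n cosB sinB cospi sinpi c12 s12 c1 s1 c2 s2.
split.
- by split; rewrite pmulrn_lgt0 //; lra.
- by rewrite -!mulrnDl addrC subrK.
- split; last by rewrite r2E r3E; field; rewrite z2 z3.
  transitivity (2 * (d23 ^+ 2 / (q2 * q3)) - 1).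
    by rewrite r2E r3E; field; rewrite z2 z3.
  have -> : d23 ^+ 2 = q2 * q3 - S ^+ 2 by rewrite SE q2E q3E; ring.
  by field; rewrite !gt_eqF.
- split; last by rewrite r3E r1E; field; rewrite z1 z3.
  transitivity (2 * (d31 ^+ 2 / (q3 * q1)) - 1).
    by rewrite r1E r3E; field; rewrite z1 z3.
  have -> : d31 ^+ 2 = q3 * q1 - S ^+ 2 by rewrite SE q3E q1E; ring.
  by field; rewrite !gt_eqF.
- split; last by rewrite r1E r2E; field; rewrite z1 z2.
  transitivity (2 * (d12 ^+ 2 / (q1 * q2)) - 1).
    by rewrite r1E r2E; field; rewrite z1 z2.
  have -> : d12 ^+ 2 = q1 * q2 - S ^+ 2 by rewrite SE q1E q2E; ring.
  by field; rewrite !gt_eqF.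
Qed.

Section Wave.
Variables (a1 a2 a3 : R).
Hypothesis ap : [/\ 0 < a1, 0 < a2 & 0 < a3].
Hypothesis sum2pi : a1 + a2 + a3 = 2 * pi.

Definition wangle th (z : lat) : R := th + z.1%:~R * a1 - z.2%:~R * a3.

(** The representative of the angle in the period that starts at [- rho]: then
    both the arc [[- rho, rho]] and its complement are intervals of heights. *)
Definition wlift th rho z : R :=
  wangle th z - (Num.floor ((wangle th z + rho) / (2 * pi)))%:~R * (2 * pi).

Let pi0 : 0 < 2 * pi :> R. Proof. by rewrite mulr_gt0 // pi_gt0. Qed.

Lemma wlift_bounds th rho z : - rho <= wlift th rho z < - rho + 2 * pi.
Proof.
rewrite /wlift; set w := wangle th z; set n := Num.floor _.
have /andP[] := floor_itv ((w + rho) / (2 * pi)); rewrite -/n intrD.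
rewrite ler_pdivlMr // ltr_pdivrMr // => h1 h2; apply/andP; split; lra.
Qed.

Lemma cos_addn x (n : nat) : cos (x + n%:R * (2 * pi)) = cos x.
Proof.
elim: n => [|n IH]; first by rewrite mul0r addr0.
by rewrite -natr1 mulrDl mul1r addrA cos_add2pi.
Qed.

Lemma cos_addz x (m : int) : cos (x + m%:~R * (2 * pi)) = cos x.
Proof.
case: m => n; first exact: cos_addn.
by rewrite NegzE intrN mulNr -[LHS](cos_addn _ n.+1) -pmulrn subrK.
Qed.

Lemma cos_wlift th rho z : cos (wlift th rho z) = cos (wangle th z).
Proof. by rewrite /wlift -mulNr -intrN cos_addz. Qed.

Lemma wlift_angle th rho : angle_lift (wlift th rho) (- rho) a1 a2 a3.
Proof.
have [p1 p2 p3] := ap.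
have step z u (a : R) (k : int) : 0 < a -> a < 2 * pi ->
    wangle th (z + u) = wangle th z + a + k%:~R * (2 * pi) ->
    wlift th rho (z + u) = wlift th rho z + a \/
    wlift th rho (z + u) = wlift th rho z + a - (a1 + a2 + a3).
  move=> ap' al e; rewrite sum2pi.
  have /andP[] := wlift_bounds th rho z; have /andP[] := wlift_bounds th rho (z + u).
  have [n nE] : exists n : int,
      wlift th rho (z + u) = wlift th rho z + a + n%:~R * (2 * pi).
    rewrite /wlift e; set n1 := Num.floor _; set n2 := Num.floor _.
    by exists (k + n2 - n1); rewrite !(intrD, intrN); ring.
  rewrite nE; move: (wlift th rho z) pi0 al; move: (2 * pi) => P t P0 aP h1 h2 h3 h4.
  have n1 : - (1 + 1) < n.
    by rewrite -(ltr_int R) -(ltr_pM2r P0) !(intrN, intrD) !mulr1z; lra.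
  have n2 : n < (1 : int).
    by rewrite -(ltr_int R) -(ltr_pM2r P0) mul1r; lra.
  have [->|->] : n = 0 \/ n = -1 by move: n1 n2; clear; lia.
    by left; rewrite mul0r addr0.
  by right; rewrite mulN1r.
split=> //; split; first by move=> z; rewrite sum2pi wlift_bounds.
split=> z.
- apply: (step _ _ _ 0) => //; first by rewrite -sum2pi; lra.
  by rewrite /wangle /= !intrD /=; ring.
- apply: (step _ _ _ (-1)) => //; first by rewrite -sum2pi; lra.
  by rewrite /wangle /= !(intrD, intrN) -sum2pi; ring.
- apply: (step _ _ _ 0) => //; first by rewrite -sum2pi; lra.
  by rewrite /wangle /= !(intrD, intrN) /=; ring.
Qed.

(** On this period the cosine is at least [cos rho] exactly up to [rho]. *)
Lemma wave_arc K D th rho z : 0 < K -> 0 < rho < pi -> D = - K * cos rho ->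
  (wlift th rho z <= rho) = (0 <= K * cos (wangle th z) + D).
Proof.
move=> K0 rho0 ->; rewrite -(cos_wlift th rho) mulNr -mulrBr pmulr_rge0 // subr_ge0.
have /andP[] := wlift_bounds th rho z; move: (wlift _ _ _) => t t1 t2.
have rpi : rho \in `[0, pi] by rewrite in_itv /=; lra.
case: (leP t pi) => tpi.
  have npi : `|t| \in `[0, pi].
    by rewrite in_itv /= normr_ge0 ler_norml; lra.
  rewrite -(cos_norm t) [RHS]leNgt (ltr_cos rpi npi) -leNgt ler_norml.
  by rewrite t1.
have cE : cos t = cos (2 * pi - t).
  by rewrite -[RHS]cosN opprB -[RHS]cos_add2pi subrK.
have spi : 2 * pi - t \in `[0, pi] by rewrite in_itv /=; lra.
rewrite cE [RHS]leNgt (ltr_cos rpi spi) -leNgt.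
by apply/idP/idP; lra.
Qed.

End Wave.
End Angles.

(** * The wave attached to a tile *)

Section Fold.
Variable R : realType.

Lemma cos_eq (x y : R) : x = y \/ x = y + 2 * pi \/ x + 2 * pi = y -> cos x = cos y.
Proof. by case=> [->//|[->|<-]]; rewrite cos_add2pi. Qed.

(** The two trigonometric identities in the hypotheses are the cosine and sine
    parts of the conclusion, which is linear in [cos ph] and [sin ph]. *)
Lemma cos_reflect (b1 b2 b3 k ph u1 u2 uz uz' : R) (s : bool) :
  cos b2 - cos b3 = k * (cos b1 - 1) -> sin b2 - sin b3 = - k * sin b1 ->
  let sg (r : R) := if s then r else - r in
  cos u1 = cos ph -> cos u2 = cos (ph + sg b1) -> cos uz = cos (ph - sg b3) ->
  cos uz' = cos (ph - sg b2) -> cos uz' = cos uz + k * (cos u2 - cos u1).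
Proof.
move=> hc hs /= -> -> -> ->; case: s; rewrite !(cosD, cosN, sinN).
  transitivity (cos ph * cos b3 + sin ph * sin b3 + (cos ph * (cos b2 - cos b3)
    + sin ph * (sin b2 - sin b3))); first by ring.
  by rewrite hc hs; ring.
transitivity (cos ph * cos b3 - sin ph * sin b3 + (cos ph * (cos b2 - cos b3)
  - sin ph * (sin b2 - sin b3))); first by ring.
by rewrite hc hs; ring.
Qed.

Variables (o a b : 'rV[R]_2).
Hypothesis ab0 : 0 < det2 a b.

(** The central angles of the triangle with sides [a], [b - a] and [- b]. *)
Definition tile_angles (a1 a2 a3 : R) :=
  [/\ [/\ 0 < a1, 0 < a2 & 0 < a3], a1 + a2 + a3 = 2 * pi &
  let q1 := dot a a in let q2 := dot (b - a) (b - a) in let q3 := dot b b in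
  let S := det2 a b in
  [/\ cos a1 = 1 - 2 * S ^+ 2 / (q2 * q3) /\
      sin a1 = 2 * S * dot (b - a) b / (q2 * q3),
    cos a2 = 1 - 2 * S ^+ 2 / (q3 * q1) /\ sin a2 = 2 * S * dot a b / (q3 * q1) &
    cos a3 = 1 - 2 * S ^+ 2 / (q1 * q2) /\
      sin a3 = - (2 * S * dot a (b - a) / (q1 * q2))]].

Lemma dot_gt0 (x y : 'rV[R]_2) : det2 x y != 0 -> 0 < dot x x.
Proof.
move=> h; rewrite lt_neqAle dot_ge0 andbT eq_sym; apply: contraNneq h.
by move/dot_eq0 => ->; rewrite /det2 !mxE !mul0r subrr.
Qed.

Lemma sides_gt0 : [/\ 0 < dot a a, 0 < dot (b - a) (b - a) & 0 < dot b b].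
Proof.
have n0 := lt0r_neq0 ab0; split; first exact: dot_gt0 n0.
  apply: (@dot_gt0 _ a).
  have -> : det2 (b - a) a = - det2 a b by rewrite /det2 !mxE; ring.
  by rewrite oppr_eq0.
apply: (@dot_gt0 _ a); have -> : det2 b a = - det2 a b by rewrite /det2; ring.
by rewrite oppr_eq0.
Qed.

Lemma tile_anglesP : exists a1 a2 a3, tile_angles a1 a2 a3.
Proof.
have [q1 q2 q3] := sides_gt0.
have [||||a1 [a2 [a3 [pos sm c1 c2 c3]]]] := @central_angles R (dot a a)
  (dot (b - a) (b - a)) (dot b b) (dot a (b - a)) (- dot (b - a) b) (- dot a b)
  (det2 a b) q1 q2 q3 ab0; try by rewrite !dotE !mxE /det2; ring.
exists a1, a2, a3; split=> //; move: c1 c2 c3.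
by rewrite !mulrN !mulNr !opprK => c1 c2 c3; split.
Qed.

Section Wave.
Variables (a1 a2 a3 : R).
Hypothesis ta : tile_angles a1 a2 a3.

Definition wave K D th y : R :=
  K * cos (th + cx o a b y * a1 - cy o a b y * a3) + D.

Lemma wave_Pt K D th z : wave K D th (Pt o a b z) = K * cos (wangle a1 a3 th z) + D.
Proof. by rewrite /wave cx_Pt // cy_Pt. Qed.

(** The wave satisfies the relation that [snell_height] gives for the signed
    distance to a trajectory at the new vertex [y1 + y2 - z] of the tile
    across the side [y1 y2]. *)
Lemma wave_reflect K D th s x l :
  let y1 := ltile o a b s x l in let y2 := ltile o a b s x (l + 1) in
  let z := ltile o a b s x (l + 2) in let e := y2 - y1 in
  wave K D th (y1 + y2 - z) = wave K D th z +
    (dot e e - 2 * dot (z - y1) e) / dot e e * (wave K D th y2 - wave K D th y1).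
Proof.
move=> y1 y2 z e; have [pos sm [[c1 s1] [c2 s2] [c3 s3]]] := ta.
have [q1 q2 q3] := sides_gt0.
have cxE : cx o a b (y1 + y2 - z) = cx o a b y1 + cx o a b y2 - cx o a b z.
  by rewrite /cx -!mulrDl -mulrBl; congr (_ / _); rewrite /det2 !mxE; ring.
have cyE : cy o a b (y1 + y2 - z) = cy o a b y1 + cy o a b y2 - cy o a b z.
  by rewrite /cy -!mulrDl -mulrBl; congr (_ / _); rewrite /det2 !mxE; ring.
pose ph : R := th + x.1%:~R * a1 - x.2%:~R * a3.
pose k1 := (dot (b - a) (b - a) - dot b b) / dot a a.
pose k2 := (dot b b - dot a a) / dot (b - a) (b - a).
pose k3 := (dot a a - dot (b - a) (b - a)) / dot b b.
have n1 := lt0r_neq0 q1; have n2 := lt0r_neq0 q2; have n3 := lt0r_neq0 q3.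
have d1 : dot a b = (dot a a + dot b b - dot (b - a) (b - a)) / 2.
  by rewrite !dotE !mxE; field.
have d2 : dot (b - a) b = (dot b b + dot (b - a) (b - a) - dot a a) / 2.
  by rewrite !dotE !mxE; field.
have d3 : dot a (b - a) = (dot b b - dot (b - a) (b - a) - dot a a) / 2.
  by rewrite !dotE !mxE; field.
have h1 : cos a2 - cos a3 = k1 * (cos a1 - 1) /\ sin a2 - sin a3 = - k1 * sin a1.
  rewrite c1 c2 c3 s1 s2 s3 /k1 d1 d2 d3; split; by field; rewrite n1 n2 n3.
have h2 : cos a3 - cos a1 = k2 * (cos a2 - 1) /\ sin a3 - sin a1 = - k2 * sin a2.
  rewrite c1 c2 c3 s1 s2 s3 /k2 d1 d2 d3; split; by field; rewrite n1 n2 n3.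
have h3 : cos a1 - cos a2 = k3 * (cos a3 - 1) /\ sin a1 - sin a2 = - k3 * sin a3.
  rewrite c1 c2 c3 s1 s2 s3 /k3 d1 d2 d3; split; by field; rewrite n1 n2 n3.
pose ang y := th + cx o a b y * a1 - cy o a b y * a3.
suff [k [kE angE]] : exists k, (dot e e - 2 * dot (z - y1) e) / dot e e = k /\
    cos (ang (y1 + y2 - z)) = cos (ang z) + k * (cos (ang y2) - cos (ang y1)).
  by rewrite kE /wave -!/(ang _) angE; ring.
have angz' : ang (y1 + y2 - z) = ang y1 + ang y2 - ang z.
  by rewrite /ang cxE cyE; ring.
have angl j : ang (ltile o a b s x j) = if j == 0 then ph
    else if s then (if j == 1 then ph + a1 else ph - a3)
    else (if j == 1 then ph - a1 else ph + a3).
  rewrite /ang /ltile cx_Pt // cy_Pt // /ph.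
  by case: (s); case: (I3P j) => -> /=; rewrite !(intrD, intrN) /=; ring.
have [a12 a23 a31] : [/\ a3 = 2 * pi - (a1 + a2), a1 = 2 * pi - (a2 + a3)
    & a2 = 2 * pi - (a3 + a1)] by rewrite -sm; split; ring.
have yE j : ltile o a b s x j = Pt o a b x + (if s then 1 else -1 : R) *:
    (if j == 0 then 0 else if j == 1 then a else b).
  rewrite /ltile /Pt; case: (s); case: (I3P j) => -> /=; apply: rv2P;
    by rewrite !mxE !(intrD, intrN) /=; ring.
have kE (p q : R) : q != 0 -> dot e e = q -> dot e e - 2 * dot (z - y1) e = p ->
  (dot e e - 2 * dot (z - y1) e) / dot e e = p / q by move=> _ -> ->.
rewrite angz' /y1 /y2 /z !angl -/y1 -/y2 -/z.
have [l0|l1|l2] := I3P l.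
- exists k1; split.
    by apply: kE => //; rewrite /e /y1 /y2 /z !yE l0 ?I3E /= !dotE !mxE;
      case: (s); ring.
  rewrite l0 ?I3E /=.
  apply: (cos_reflect (s := s) (ph := ph) h1.1 h1.2); case: (s) => //=;
    apply: cos_eq; rewrite -sm; try (by left; ring); try (by right; left; ring);
    by right; right; ring.
- exists k2; split.
    by apply: kE => //; rewrite /e /y1 /y2 /z !yE l1 ?I3E /= !dotE !mxE;
      case: (s); ring.
  rewrite l1 ?I3E /=.
  apply: (cos_reflect (s := s) (ph := if s then ph + a1 else ph - a1) h2.1 h2.2);
    case: (s) => //=;
    apply: cos_eq; rewrite -sm; try (by left; ring); try (by right; left; ring);
    by right; right; ring.
- exists k3; split.
    by apply: kE => //; rewrite /e /y1 /y2 /z !yE l2 ?I3E /= !dotE !mxE;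
      case: (s); ring.
  rewrite l2 ?I3E /=.
  apply: (cos_reflect (s := s) (ph := if s then ph - a3 else ph + a3) h3.1 h3.2);
    case: (s) => //=;
    apply: cos_eq; rewrite -sm; try (by left; ring); try (by right; left; ring);
    by right; right; ring.
Qed.

(** The three vertices lie on a circle and are not collinear, so the affine
    functions restricted to them are the functions [X cos + Y sin + D] of the
    angle. *)
Lemma wave_interpolate s x (h : 'I_3 -> R) : ~ (h 1 = h 0 /\ h 2 = h 0) ->
  exists K D th, 0 < K /\ forall l, wave K D th (ltile o a b s x l) = h l.
Proof.
move=> hn; have [pos sm [[c1 s1] [c2 s2] [c3 s3]]] := ta.
have [q1 q2 q3] := sides_gt0.
have n1 := lt0r_neq0 q1; have n2 := lt0r_neq0 q2; have n3 := lt0r_neq0 q3.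
have nS := lt0r_neq0 ab0.
pose sg : R := if s then 1 else -1.
have sg2 : sg * sg = 1 by rewrite /sg; case: (s); ring.
(* the determinant of the linear system for the coefficients of the cosine and
   the sine, once the constant is eliminated *)
pose M := (cos a1 - 1) * sin a3 + sin a1 * (cos a3 - 1).
have ME : M != 0.
  have -> : M = - (4 * det2 a b ^+ 3 / (dot a a * dot (b - a) (b - a) * dot b b)).
    rewrite /M c1 s1 c3 s3.
    have -> : dot (b - a) b = dot (b - a) (b - a) + dot a (b - a).
      by rewrite !dotE !mxE; ring.
    by field; rewrite n1 n2 n3.
  by rewrite oppr_eq0 !mulf_neq0 ?invr_neq0 ?mulf_neq0 ?expf_neq0 ?pnatr_eq0.
pose X := ((h 1 - h 0) * sin a3 + (h 2 - h 0) * sin a1) / M.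
pose Y := sg * ((cos a1 - 1) * (h 2 - h 0) - (cos a3 - 1) * (h 1 - h 0)) / M.
have XM : X * M = (h 1 - h 0) * sin a3 + (h 2 - h 0) * sin a1 by rewrite divfK.
have YM : Y * M = sg * ((cos a1 - 1) * (h 2 - h 0) - (cos a3 - 1) * (h 1 - h 0)).
  by rewrite divfK.
have e1 : X * (cos a1 - 1) - sg * Y * sin a1 = h 1 - h 0.
  apply: (mulIf ME).
  transitivity (X * M * (cos a1 - 1) - sg * (Y * M) * sin a1); first by ring.
  by rewrite XM YM mulrA sg2 /M; ring.
have e2 : X * (cos a3 - 1) + sg * Y * sin a3 = h 2 - h 0.
  apply: (mulIf ME).
  transitivity (X * M * (cos a3 - 1) + sg * (Y * M) * sin a3); first by ring.
  by rewrite XM YM mulrA sg2 /M; ring.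
have XY : (X, Y) != (0, 0).
  apply/eqP => -[X0 Y0]; apply: hn.
  by rewrite X0 Y0 in e1 e2; split; apply/eqP; rewrite -subr_eq0 -?e1 -?e2; apply/eqP; ring.
have [K [ps [K0 XE YE]]] := polar XY.
exists K, (h 0 - X), (ps - x.1%:~R * a1 + x.2%:~R * a3); split=> // l.
rewrite wave_Pt /wangle.
have [->|->|->] := I3P l.
- rewrite /= /sgl /off /=.
  have -> : ps - x.1%:~R * a1 + x.2%:~R * a3 +
    (x + (if s then 0 else - 0)).1%:~R * a1 - (x + (if s then 0 else - 0)).2%:~R * a3 = ps.
    by case: (s); rewrite /= !(intrD, intrN) /=; ring.
  by rewrite -XE; ring.
- have -> : ps - x.1%:~R * a1 + x.2%:~R * a3 +
    (x + sgl s (off 1)).1%:~R * a1 - (x + sgl s (off 1)).2%:~R * a3 = ps + sg * a1.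
    by rewrite /sg; case: (s); rewrite /= !(intrD, intrN) /=; ring.
  rewrite cosD mulrBr !mulrA -XE -YE.
  have [-> ->] : cos (sg * a1) = cos a1 /\ sin (sg * a1) = sg * sin a1.
    by rewrite /sg; case: (s); rewrite ?mul1r ?mulN1r ?cosN ?sinN.
  by rewrite -[RHS](subrK (h 0)) -e1; ring.
- have -> : ps - x.1%:~R * a1 + x.2%:~R * a3 +
    (x + sgl s (off 2)).1%:~R * a1 - (x + sgl s (off 2)).2%:~R * a3 = ps - sg * a3.
    by rewrite /sg; case: (s); rewrite /= !(intrD, intrN) /=; ring.
  rewrite cosB mulrDr !mulrA -XE -YE.
  have [-> ->] : cos (sg * a3) = cos a3 /\ sin (sg * a3) = sg * sin a3.
    by rewrite /sg; case: (s); rewrite ?mul1r ?mulN1r ?cosN ?sinN.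
  by rewrite -[RHS](subrK (h 0)) -e2; ring.
Qed.

End Wave.
End Fold.

(** * Snell's law and the wave *)

Section Snell.
Variable R : realType.
Implicit Types (u v x y z : 'rV[R]_2) (t : 'I_3 -> 'rV[R]_2) (k : 'I_3).

(** Refraction keeps the normal component of the direction, so the height
    keeps its values on the common edge; it reverses the tangential component,
    so the derivative of the height across the edge changes sign. *)
Lemma snell_height y1 y2 z v p p' (r s : R) :
  let e := y2 - y1 in let v' := refract e v in
  dot e e != 0 -> p' = p + r *: v -> p' = (1 - s) *: y1 + s *: y2 ->
  [/\ det2 v' (y1 - p') = det2 v (y1 - p), det2 v' (y2 - p') = det2 v (y2 - p) &
    det2 v' (y1 + y2 - z - p') = det2 v (z - p) +
      (dot e e - 2 * dot (z - y1) e) / dot e e *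
      (det2 v (y2 - p) - det2 v (y1 - p))].
Proof.
move=> e v' e0 pE p'E.
have pE' : p = (1 - s) *: y1 + s *: y2 - r *: v by rewrite -p'E pE addrK.
have dE : dot e e = e 0 0 * e 0 0 + e 0 1 * e 0 1 by rewrite dotE.
move: e0; rewrite pE' p'E /v' /refract /normal_part /tangent_part.
have y2E : y2 = y1 + e by rewrite addrC subrK.
rewrite y2E; clear v' dE y2E; clearbody e; rewrite dotE => e0.
by split; rewrite /det2 !dotE !mxE; field.
Qed.

Lemma csym_triangle m t : central_symmetry m @` triangle t =
  triangle (fun k => central_symmetry m (t k)).
Proof.
have c (w : 'I_3 -> R) : \sum_k w k = 1 ->
    central_symmetry m (\sum_k w k *: t k) = \sum_k w k *: central_symmetry m (t k).
  rewrite !sum3 => w1; have w0 : w 0 = 1 - w 1 - w 2 by lra.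
  by rewrite /central_symmetry w0; apply: rv2P; rewrite !mxE; ring.
apply/seteqP; split=> y.
  by move=> [_ [w [w0 w1] <-] <-]; exists w => //; rewrite c.
by move=> [w [w0 w1] <-]; exists (\sum_k w k *: t k); [exists w|exact: c].
Qed.

Lemma det2_bar t u q y : area t != 0 ->
  det2 u (y - q) = \sum_k bar t k y * det2 u (t k - q).
Proof.
move=> nd; have s1 := bar_sum y nd; rewrite {1}(bar_comb y nd) sum3.
have -> : bar t 0 y = 1 - bar t 1 y - bar t 2 y by lra.
by rewrite /det2 !mxE; ring.
Qed.

Lemma det2_parallel u x y : u != 0 -> det2 u x = 0 -> det2 u y = 0 -> det2 x y = 0.
Proof.
move=> u0; rewrite /det2 => hx hy.
have [u00|u00] := eqVneq (u 0 0) 0; last first.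
  apply: (mulfI u00); rewrite mulr0.
  transitivity (x 0 0 * (u 0 0 * y 0 1 - u 0 1 * y 0 0)
    - y 0 0 * (u 0 0 * x 0 1 - u 0 1 * x 0 0)); first by ring.
  by rewrite hx hy; ring.
have u01 : u 0 1 != 0.
  by apply: contraNneq u0 => u01; apply/eqP/rv2P; rewrite mxE.
apply: (mulfI u01); rewrite mulr0.
transitivity (x 0 1 * (u 0 0 * y 0 1 - u 0 1 * y 0 0)
    - y 0 1 * (u 0 0 * x 0 1 - u 0 1 * x 0 0)); first by ring.
by rewrite hx hy; ring.
Qed.

Lemma segment_eq_ends (x y z w : 'rV[R]_2) : x != y -> segment x y = segment z w ->
  (x = z /\ y = w) \/ (x = w /\ y = z).
Proof.
move=> xy e.
have in0 (x' y' : 'rV[R]_2) : segment x' y' x'.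
  by exists 0; [rewrite /= lexx ler01|rewrite subr0 scale1r scale0r addr0].
have in1 (x' y' : 'rV[R]_2) : segment x' y' y'.
  by exists 1; [rewrite /= lexx ler01|rewrite subrr scale1r scale0r add0r].
have [r /andP[r0 r1] zE] : segment x y z by rewrite e.
have [q /andP[q0 q1] wE] : segment x y w by rewrite e.
have [s /andP[s0 s1] xE] : segment z w x by rewrite -e.
have [s' /andP[s0' s1'] yE] : segment z w y by rewrite -e.
have par (k l : R) : (1 - k) *: x + k *: y = (1 - l) *: x + l *: y -> k = l.
  move=> h; have : (k - l) *: (y - x) = 0.
    transitivity ((1 - k) *: x + k *: y - ((1 - l) *: x + l *: y)).
      by apply: rv2P; rewrite !mxE; ring.
    by rewrite h subrr.
  move/eqP; rewrite scaler_eq0 !subr_eq0 => /orP[/eqP//|/eqP yx].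
  by rewrite yx eqxx in xy.
have h0 : 0 = (1 - s) * r + s * q.
  apply: par; rewrite subr0 scale1r scale0r addr0 -[LHS]xE -zE -wE.
  by apply: rv2P; rewrite !mxE; ring.
have h1 : 1 = (1 - s') * r + s' * q.
  apply: par; rewrite subrr scale1r scale0r add0r -[LHS]yE -zE -wE.
  by apply: rv2P; rewrite !mxE; ring.
have [r0'|rn0] := eqVneq r 0.
  have q1' : q = 1.
    have : s' * q = 1 by rewrite [RHS]h1 r0'; ring.
    by nra.
  by left; rewrite -zE -wE r0' q1' !(subr0, subrr, scale1r, scale0r, addr0, add0r).
have rp : 0 < r by rewrite lt_neqAle eq_sym rn0.
have s1E : s = 1.
  have : 0 <= s * q by exact: mulr_ge0.
  have : 0 <= (1 - s) * r by apply: mulr_ge0 => //; lra.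
  move=> g1 g2; have /eqP : (1 - s) * r = 0 by lra.
  by rewrite mulf_eq0 (negbTE rn0) orbF subr_eq0 => /eqP.
have q0' : q = 0 by move: h0; rewrite s1E; lra.
have r1' : r = 1.
  have : (1 - s') * r = 1 by rewrite [RHS]h1 q0'; ring.
  by nra.
by right; rewrite -zE -wE r1' q0' !(subr0, subrr, scale1r, scale0r, addr0, add0r).
Qed.
End Snell.

Section Heights.
Variables (R : realType) (I : Type) (tau : I -> 'I_3 -> 'rV[R]_2).
Variables (c : nat -> I) (p v : nat -> 'rV[R]_2) (o a b : 'rV[R]_2).
Hypothesis ptau : periodic_triangle_tiling tau.
Hypothesis traj : trajectory tau c p v.
Hypothesis ab0 : 0 < det2 a b.
Hypothesis latt :
  forall i, exists s x, triangle (tau i) = triangle (ltile o a b s x).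
Implicit Types (i j : I) (k l : 'I_3) (n : nat) (x y z : 'rV[R]_2).

Lemma ptile_area i : area (tau i) != 0.
Proof. by apply: tile_area; case: ptau. Qed.

Lemma next_on_side n : exists k l, [/\ c n <> c n.+1,
   side (tau (c n)) k = side (tau (c n.+1)) l, open_side (tau (c n)) k (p n.+1)
  & v n.+1 = refract (tau (c n) (k + 1) - tau (c n) k) (v n)].
Proof. by have [h _] := traj; have [_ _] := h n. Qed.

Lemma open_side_bar (t : 'I_3 -> 'rV[R]_2) k y : area t != 0 ->
  open_side t k y -> side t k y.
Proof. by move=> nd [s /= /andP[s0 s1] <-]; exists s => //=; rewrite !ltW. Qed.

Lemma velocity_neq0 n : v n != 0.
Proof.
have [h _] := traj; have [[s s0 pE] int _] := h n.
apply/eqP => v0; have pp : p n.+1 = p n by rewrite pE v0 scaler0 addr0.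
have [k [l [_ _ os _]]] := next_on_side n.
have : open_segment (p n) (p n.+1) (p n.+1).
  exists 2^-1; first by rewrite /=; apply/andP; split; lra.
  by rewrite pp -scalerDl subrK scale1r.
move/int => /(interior_bar (k + 2) (ptile_area _)).
by rewrite (side_bar (ptile_area _) (open_side_bar (ptile_area _) os)) ltxx.
Qed.

Lemma tile_labels i : exists s (x : lat) (pi : 'I_3 -> 'I_3), injective pi /\
  forall k, tau i k = ltile o a b s x (pi k).
Proof.
have [s [x e]] := latt i.
have nd := ltile_area0 o ab0 s x.
have [pi piE] := choice (fun k => triangle_eq_vertex k (ptile_area i) nd e).
exists s, x, pi; split=> // k l kl; apply: (vertex_inj (ptile_area i)).
by rewrite !piE kl.
Qed.

Lemma tile_third i k : exists s (x : lat) l, tau i (k + 2) = ltile o a b s x (l + 2) /\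
  ((tau i k = ltile o a b s x l /\ tau i (k + 1) = ltile o a b s x (l + 1)) \/
   (tau i k = ltile o a b s x (l + 1) /\ tau i (k + 1) = ltile o a b s x l)).
Proof.
have [s [x [pi [inj piE]]]] := tile_labels i; exists s, x, (pi (k + 2) + 1).
have n1 : pi k != pi (k + 2) by apply/eqP => /inj/eqP; case: (I3P k) => ->.
have n2 : pi (k + 1) != pi (k + 2) by apply/eqP => /inj/eqP; case: (I3P k) => ->.
have n3 : pi k != pi (k + 1) by apply/eqP => /inj/eqP; case: (I3P k) => ->.
rewrite !piE; move: n1 n2 n3.
case: (I3P (pi k)) => ->; case: (I3P (pi (k + 1))) => ->;
  case: (I3P (pi (k + 2))) => -> //= _ _ _; rewrite !I3E;
  by split=> //; tauto.
Qed.

Lemma shared_side_image n k l : c n <> c n.+1 ->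
  side (tau (c n)) k = side (tau (c n.+1)) l ->
  forall m, [\/ tau (c n.+1) m = tau (c n) k, tau (c n.+1) m = tau (c n) (k + 1) |
    tau (c n.+1) m = tau (c n) k + tau (c n) (k + 1) - tau (c n) (k + 2)].
Proof.
move=> nn sE m; have [_ _ sym] := ptau.
have := sym _ _ _ _ nn sE; rewrite csym_triangle => e.
set m0 := midpoint _ _ in e.
have nd' : area (fun j : 'I_3 => central_symmetry m0 (tau (c n) j)) != 0.
  have -> : area (fun j : 'I_3 => central_symmetry m0 (tau (c n) j)) = area (tau (c n)).
    by rewrite /area /central_symmetry /det2 !mxE; ring.
  exact: ptile_area.
have [j ->] := triangle_eq_vertex m (ptile_area _) nd' (esym e).
have mE : 2 *: m0 = tau (c n) k + tau (c n) (k + 1).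
  by rewrite /m0 /midpoint scalerA divff ?scale1r ?pnatr_eq0.
rewrite /central_symmetry mE.
have : [\/ j = k, j = k + 1 | j = k + 2].
  by case: (I3P k) => ->; case: (I3P j) => ->; rewrite ?I3E;
    [apply: Or31|apply: Or32|apply: Or33|apply: Or33|apply: Or31|apply: Or32
    |apply: Or32|apply: Or33|apply: Or31].
case=> ->; [apply: Or32|apply: Or31|exact: Or33].
  by rewrite addrAC subrr add0r.
by rewrite addrK.
Qed.

(** The wave is chosen to agree with the signed distance on the first tile;
    [snell_height] and [wave_reflect] propagate the agreement from each tile
    to the next one. *)
Lemma height_wave a1 a2 a3 : tile_angles a b a1 a2 a3 ->
  exists K D th, 0 < K /\ forall n k,
    det2 (v n) (tau (c n) k - p n) = wave o a b a1 a3 K D th (tau (c n) k).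
Proof.
move=> ta.
have [s0 [x0 e0]] := latt (c 0%N).
have nd0 := ltile_area0 o ab0 s0 x0.
pose h l := det2 (v 0%N) (ltile o a b s0 x0 l - p 0%N).
have hn : ~ (h 1 = h 0 /\ h 2 = h 0).
  rewrite /h /ltile => -[h1 h2].
  have d1 : det2 (v 0%N) (ltile o a b s0 x0 1 - ltile o a b s0 x0 0) = 0.
    by move: h1; rewrite /ltile /det2 !mxE; lra.
  have d2 : det2 (v 0%N) (ltile o a b s0 x0 2 - ltile o a b s0 x0 0) = 0.
    by move: h2; rewrite /ltile /det2 !mxE; lra.
  by move: nd0; rewrite /area (det2_parallel (velocity_neq0 0) d1 d2) eqxx.
have [K [D [th [K0 hE]]]] := wave_interpolate o ab0 ta s0 x0 hn.
exists K, D, th; split=> //; elim=> [|n IH] k.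
  by have [l ->] := triangle_eq_vertex k (ptile_area _) nd0 e0; rewrite hE.
have [k0 [l0 [nn sE os vE]]] := next_on_side n.
have [h' _] := traj; have [[r _ pE] _ _] := h' n.
have [q _ qE] := os.
have ee : dot (tau (c n) (k0 + 1) - tau (c n) k0)
    (tau (c n) (k0 + 1) - tau (c n) k0) != 0.
  apply: contraNneq (ptile_area (c n)) => /dot_eq0 /eqP; rewrite subr_eq0 => /eqP kk.
  by have := vertex_inj (ptile_area (c n)) kk; case: (I3P k0) => ->.
have [g1 g2 g3] := snell_height (tau (c n) (k0 + 2)) ee pE (esym qE).
rewrite vE; case: (shared_side_image nn sE k) => ->.
- by rewrite g1 IH.
- by rewrite g2 IH.
rewrite g3 !IH; have [s [x [l [zE yE]]]] := tile_third (c n) k0.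
have := wave_reflect o ab0 ta K D th s x l.
rewrite /= zE; case: yE => -[-> ->]; first by move->.
move=> wr; rewrite [ltile o a b s x (l + 1) + ltile o a b s x l]addrC wr {wr}.
set y1 := ltile o a b s x l; set y2 := ltile o a b s x (l + 1).
set z := ltile o a b s x (l + 2).
have -> : dot (y1 - y2) (y1 - y2) = dot (y2 - y1) (y2 - y1).
  by rewrite !dotE !mxE; ring.
have -> : dot (z - y2) (y1 - y2) = dot (y2 - y1) (y2 - y1) - dot (z - y1) (y2 - y1).
  by rewrite !dotE !mxE; ring.
by ring.
Qed.

End Heights.

(** * The curve in the zero set of the folded height *)

Section Domain.
Variables (R : realType) (I : Type) (tau : I -> 'I_3 -> 'rV[R]_2).
Variables (c : nat -> I) (p v : nat -> 'rV[R]_2) (Omega : set 'rV[R]_2).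
Variable H : 'rV[R]_2 -> R.
Hypothesis ptau : periodic_triangle_tiling tau.
Hypothesis traj : trajectory tau c p v.
Hypothesis enc : enclosed_domain (curve p) Omega.
Hypothesis heightE : forall n k,
  det2 (v n) (tau (c n) k - p n) = H (tau (c n) k).
Implicit Types (i j : I) (k l : 'I_3) (n : nat) (x y z : 'rV[R]_2).

Let tiling : triangle_tiling tau. Proof. by case: ptau. Qed.
Let e2e : edge_to_edge tau. Proof. by case: ptau. Qed.
Let nd i : area (tau i) != 0. Proof. exact: tile_area. Qed.

Let openO : open Omega. Proof. by case: enc. Qed.

Lemma vertex_off_curve i k : ~ curve p (tau i k).
Proof. by have [_] := traj; apply. Qed.

Lemma segment_l x y : segment x y x.
Proof. by exists 0; [rewrite /= lexx ler01|rewrite subr0 scale1r scale0r addr0]. Qed.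

Lemma segment_r x y : segment x y y.
Proof. by exists 1; [rewrite /= lexx ler01|rewrite subrr scale1r scale0r add0r]. Qed.

Lemma segmentC x y : segment x y = segment y x.
Proof.
have sub (a b : 'rV[R]_2) z : segment a b z -> segment b a z.
  move=> [s /= /andP[s0 s1] <-]; exists (1 - s); first by apply/andP; split; lra.
  by apply: rv2P; rewrite !mxE; ring.
by apply/seteqP; split=> z; exact: sub.
Qed.

Lemma connected_segment x y : connected (segment x y).
Proof.
apply: connected_continuous_connected.
  have -> : [set s : R | 0 <= s <= 1] = `[0, 1]%classic.
    by apply/seteqP; split=> s /=; rewrite in_itv.
  exact: segment_connected.
apply: continuous_subspaceT => s.
apply: cvgD; apply: cvgZl; last exact: cvg_id.
by apply: cvgB; [exact: cvg_cst|exact: cvg_id].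
Qed.

(** The boundary of the domain is the curve, so a segment that avoids it lies
    inside or outside. *)
Lemma segment_in_domain x y : Omega x ->
  (forall z, segment x y z -> ~ curve p z) -> Omega y.
Proof.
move=> Ox off; have [_ _ _ _ bd] := enc.
have e : segment x y `&` Omega = segment x y.
  apply: connected_segment.
  - by exists x; split=> //; exact: segment_l.
  - by exists Omega.
  - exists (closure Omega); first exact: closed_closure.
    apply/seteqP; split=> z [sz Oz]; split=> //; first exact: subset_closure.
    apply: contrapT => nOz; apply: (off z sz); rewrite -bd; split=> //.
    by move/interior_id: openO => ->.
by have [] : (segment x y `&` Omega) y by rewrite e; exact: segment_r.
Qed.

(** * The folded height, interpolated over the tiles *)

(** The folded height, extended affinely to each tile. *)
Definition fheight i y : R := \sum_k bar (tau i) k y * H (tau i k).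

Lemma fheight_vertex i k : fheight i (tau i k) = H (tau i k).
Proof.
rewrite /fheight sum3 !bar_vertex //.
by case: (I3P k) => -> /=; rewrite !(mul0r, mul1r, add0r, addr0).
Qed.

Lemma fheight_aff i x y (s : R) :
  fheight i ((1 - s) *: x + s *: y) = (1 - s) * fheight i x + s * fheight i y.
Proof. by rewrite /fheight !sum3 !bar_aff; ring. Qed.

Lemma fheight_tile n y : fheight (c n) y = det2 (v n) (y - p n).
Proof. by rewrite (det2_bar _ _ _ (nd (c n))); apply: eq_bigr => k _; rewrite heightE. Qed.

(** Two tiles meet in a common vertex or a common side, where the
    interpolation only involves the common vertices. *)
Lemma fheight_agree i j y : triangle (tau i) y -> triangle (tau j) y -> fheight i y = fheight j y.
Proof.
move=> yi yj; have [->//|ij] := pselect (i = j).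
have yij : (triangle (tau i) `&` triangle (tau j)) y by [].
case: (e2e ij) => [e|[k [l [kl e]]]|[k [l [sE e]]]].
- by rewrite e in yij.
- by move: yij; rewrite e => ->; rewrite fheight_vertex kl fheight_vertex.
move: yij; rewrite e => sy; have := sy; rewrite sE => -[s _ <-].
have kk : tau j l != tau j (l + 1).
  by apply/eqP => /(vertex_inj (nd j)); case: (I3P l) => ->.
have e' : segment (tau j l) (tau j (l + 1)) = segment (tau i k) (tau i (k + 1)).
  by [].
have [[h1 h2]|[h1 h2]] := segment_eq_ends kk e'.
  by rewrite !fheight_aff !fheight_vertex h1 h2 !fheight_vertex.
by rewrite !fheight_aff !fheight_vertex h1 h2 !fheight_vertex.
Qed.

Lemma chord_in_tile n y : segment (p n) (p n.+1) y -> triangle (tau (c n)) y.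
Proof.
have [h _] := traj; have [_ int _] := h n.
have op s : 0 < s < 1 -> triangle (tau (c n)) ((1 - s) *: p n + s *: p n.+1).
  by move=> s01; apply: interior_subset; apply: int; exists s.
have lim (x d : 'rV[R]_2) : (forall s : R, 0 < s < 1 -> triangle (tau (c n)) (x + s *: d)) ->
    triangle (tau (c n)) x.
  move=> hs; apply: contrapT => xn.
  have o : nbhs x (~` triangle (tau (c n))).
    by apply: open_nbhs_nbhs; split=> //; apply: closed_openC; exact: closed_triangle.
  have [e e0 he] := open_dir d o.
  pose s := Num.min (e / 2) (1 / 2).
  have [s0 se s1] : [/\ 0 < s, s < e & s < 1].
    by rewrite /s; case: (ltP (e / 2) (1 / 2)) => ?; split; lra.
  by apply: (he s); [rewrite ltW|apply: hs; rewrite s0].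
move=> [s /= /andP[s0 s1] <-].
have [s0'|sn0] := eqVneq s 0.
  rewrite s0' subr0 scale1r scale0r addr0.
  apply: (lim _ (p n.+1 - p n)) => r /op.
  by congr (triangle _ _); apply: rv2P; rewrite !mxE; ring.
have [s1'|sn1] := eqVneq s 1.
  rewrite s1' subrr scale1r scale0r add0r.
  apply: (lim _ (p n - p n.+1)) => r /andP[r0 r1].
  have /op : 0 < 1 - r < 1 by lra.
  by congr (triangle _ _); apply: rv2P; rewrite !mxE; ring.
by apply: op; rewrite !lt_neqAle eq_sym sn0 s0 sn1 s1.
Qed.

Lemma fheight_chord n y : segment (p n) (p n.+1) y -> fheight (c n) y = 0.
Proof.
have [h _] := traj; have [[s s0 pE] _ _] := h n.
move=> [r _ <-]; rewrite fheight_tile pE.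
by rewrite /det2 !mxE; ring.
Qed.

Lemma fheight_curve i y : curve p y -> triangle (tau i) y -> fheight i y = 0.
Proof.
move=> [n _ sy] yi; rewrite (fheight_agree yi (chord_in_tile sy)).
exact: fheight_chord.
Qed.

Lemma chord_midpoint n : exists2 q, segment (p n) (p n.+1) q &
  (triangle (tau (c n)))° q.
Proof.
have [h _] := traj; have [_ int _] := h n.
exists ((1 - 2^-1) *: p n + 2^-1 *: p n.+1).
  by exists 2^-1 => //=; apply/andP; split; lra.
by apply: int; exists 2^-1 => //=; apply/andP; split; lra.
Qed.

(** The direction of the chord is not that of the side, since the chord runs
    in the interior of the tile; so the height, which vanishes at one interior
    point of the side, takes opposite signs at its ends. *)
Lemma curve_side_sign n k y : side (tau (c n)) k y -> curve p y ->
  H (tau (c n) k) < 0 < H (tau (c n) (k + 1)) \/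
  H (tau (c n) (k + 1)) < 0 < H (tau (c n) k).
Proof.
move=> sy cy; set A := tau (c n) k; set B := tau (c n) (k + 1).
have yT : triangle (tau (c n)) y.
  case: sy => s /= s01 <-.
  by apply: triangle_convex => //; exact: triangle_vertex.
have := fheight_curve cy yT; case: sy => s /= /andP[s0 s1] yE.
rewrite -yE fheight_aff !fheight_vertex -/A -/B => h0.
have sn0 : s != 0.
  apply/eqP => s0'; apply: (@vertex_off_curve (c n) k).
  by move: cy; rewrite -yE s0' subr0 scale1r scale0r addr0.
have sn1 : s != 1.
  apply/eqP => s1'; apply: (@vertex_off_curve (c n) (k + 1)).
  by move: cy; rewrite -yE s1' subrr scale1r scale0r add0r.
have sp : 0 < s by rewrite lt_neqAle eq_sym sn0.
have sl : 0 < 1 - s by rewrite subr_gt0 lt_neqAle sn1.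
have [A0|A0|A0] := ltgtP (H A) 0.
- left; rewrite andTb; have : (1 - s) * H A < 0 by rewrite pmulr_rlt0.
  by move=> h; rewrite -(pmulr_rgt0 _ sp); lra.
- right; have : 0 < (1 - s) * H A by rewrite pmulr_rgt0.
  by move=> h; rewrite andbT -(pmulr_rlt0 _ sp); lra.
have B0 : H B = 0.
  by move: h0; rewrite A0 mulr0 add0r => /eqP; rewrite mulf_eq0 (negbTE sn0) => /eqP.
have [q qs qi] := chord_midpoint n.
have := interior_bar (k + 2) (nd (c n)) qi.
have v0 := velocity_neq0 ptau traj n.
have hq := fheight_chord qs; rewrite fheight_tile in hq.
have hA := heightE n k; have hB := heightE n (k + 1).
rewrite -/A A0 in hA; rewrite -/B B0 in hB.
have dA : det2 (v n) (A - q) = 0.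
  by move: hA hq; rewrite /det2 !mxE; lra.
have dB : det2 (v n) (B - q) = 0.
  by move: hB hq; rewrite /det2 !mxE; lra.
rewrite /bar.
have -> : tau (c n) (k + 2 + 1) = A by rewrite /A; case: (I3P k) => ->; rewrite ?I3E.
have -> : tau (c n) (k + 2 + 2) = B by rewrite /B; case: (I3P k) => ->; rewrite ?I3E.
by rewrite (det2_parallel v0 dA dB) mul0r ltxx.
Qed.

(** * The side of the curve on which the domain lies *)

Definition halftile (s : R) i y := triangle (tau i) y /\ 0 < s * fheight i y.

(** The part of a tile where the folded height has a given sign is convex and
    avoids the curve, so it lies entirely inside the domain or entirely
    outside. *)
Lemma halftile_spread s i x y : halftile s i x -> halftile s i y -> Omega x -> Omega y.
Proof.
move=> [xT xs] [yT ys] Ox; apply: (segment_in_domain Ox) => z [r /= r01 <-] cz.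
have := fheight_curve cz (triangle_convex (nd i) xT yT r01).
rewrite fheight_aff => h0.
have : 0 < (1 - r) * (s * fheight i x) + r * (s * fheight i y).
  have [r0|r0] := eqVneq r 0; first by rewrite r0 subr0 mul1r mul0r addr0.
  case/andP: r01 => r0' r1'.
  apply: ltr_wpDl; first by apply: mulr_ge0; [lra|exact: ltW].
  by rewrite mulr_gt0 // lt_neqAle eq_sym r0.
have -> : (1 - r) * (s * fheight i x) + r * (s * fheight i y)
  = s * ((1 - r) * fheight i x + r * fheight i y) by ring.
by rewrite h0 mulr0 ltxx.
Qed.

(** The domain lies on the side of sign [s] of the [n]-th chord. *)
Definition inner s n := exists2 y, halftile s (c n) y & Omega y.

Definition is_sign (s : R) := s = 1 \/ s = -1.

Lemma shared_vertex s n : is_sign s -> exists k,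
  halftile s (c n) (tau (c n) k) /\ halftile s (c n.+1) (tau (c n) k).
Proof.
move=> sg; have [k [l [nn sE os _]]] := next_on_side traj n.
have sp := open_side_bar (nd (c n)) os.
have cp : curve p (p n.+1) by exists n => //; exact: segment_r.
have shared m : side (tau (c n)) k (tau (c n) m) ->
    0 < s * H (tau (c n) m) -> halftile s (c n) (tau (c n) m) /\
      halftile s (c n.+1) (tau (c n) m).
  move=> sm hm; have T1 : triangle (tau (c n)) (tau (c n) m) by exact: triangle_vertex.
  have T2 : triangle (tau (c n.+1)) (tau (c n) m).
    move: sm; rewrite sE => -[r /= r01 <-].
    by apply: triangle_convex => //; exact: triangle_vertex.
  by rewrite /halftile -(fheight_agree T1 T2) fheight_vertex.
have [] := curve_side_sign sp cp => /andP[h1 h2]; case: sg => sg.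
- by exists (k + 1); apply: shared; [exact: segment_r|rewrite sg mul1r].
- by exists k; apply: shared; [exact: segment_l|rewrite sg mulN1r oppr_gt0].
- by exists k; apply: shared; [exact: segment_l|rewrite sg mul1r].
- by exists (k + 1); apply: shared; [exact: segment_r|rewrite sg mulN1r oppr_gt0].
Qed.

(** The side through which the trajectory passes from a tile to the next one
    has an end of each sign, which belongs to both tiles. *)
Lemma inner_step s n : is_sign s -> inner s n <-> inner s n.+1.
Proof.
move=> sg; have [k [h1 h2]] := shared_vertex n sg.
split=> -[y hy Oy]; exists (tau (c n) k) => //.
  exact: halftile_spread hy h1 Oy.
exact: halftile_spread hy h2 Oy.
Qed.

Lemma innerE s n : is_sign s -> inner s n <-> inner s 0.
Proof. by move=> sg; elim: n => // n IH; rewrite -inner_step. Qed.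

Lemma inner_vertex s : is_sign s -> inner s 0 -> exists k, Omega (tau (c 0) k).
Proof.
move=> sg [y hy Oy]; have [k [h1 _]] := shared_vertex 0 sg.
by exists k; exact: halftile_spread hy h1 Oy.
Qed.

(** The curve is the boundary of the domain, so there are points of the domain
    near the middle of the first chord; they can be moved off the chord. *)
Lemma ex_inner : exists2 s, is_sign s & inner s 0.
Proof.
have [_ _ _ _ bd] := enc; have [q qs qi] := chord_midpoint 0.
have cq : curve p q by exists 0%N.
have [clq _] : boundary Omega q by rewrite bd.
have nq : nbhs q (triangle (tau (c 0)))°.
  by apply: open_nbhs_nbhs; split=> //; exact: open_interior.
have [w [Ow wi]] := clq _ nq; have wT := interior_subset wi.
have [h|h|h] := ltgtP (fheight (c 0) w) 0.
- exists (-1); first by right.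
  by exists w => //; split=> //; rewrite mulN1r oppr_gt0.
- by exists 1; [left|exists w => //; split=> //; rewrite mul1r].
have [k [[kT hk] _]] := shared_vertex 0 (or_introl erefl).
exists 1; first by left.
have [e e0 he] := open_dir (tau (c 0) k - w) (open_nbhs_nbhs (conj openO Ow)).
pose s := Num.min (e / 2) (1 / 2).
have [s0 se s1] : [/\ 0 < s, s < e & s < 1].
  by rewrite /s; case: (ltP (e / 2) (1 / 2)) => ?; split; lra.
exists ((1 - s) *: w + s *: tau (c 0) k).
  split; first by apply: triangle_convex => //; rewrite !ltW.
  by rewrite fheight_aff h mulr0 add0r mul1r mulr_gt0 // -[fheight _ _]mul1r.
have /he : 0 <= s < e by rewrite ltW.
by congr Omega; apply: rv2P; rewrite !mxE; ring.
Qed.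

End Domain.

(** * The vertices inside the curve *)

Section Enclosed.
Variables (R : realType) (I : Type) (tau : I -> 'I_3 -> 'rV[R]_2).
Variables (c : nat -> I) (p v : nat -> 'rV[R]_2) (Omega : set 'rV[R]_2).
Variables (o a b : 'rV[R]_2) (H : 'rV[R]_2 -> R).
Hypothesis ptau : periodic_triangle_tiling tau.
Hypothesis traj : trajectory tau c p v.
Hypothesis enc : enclosed_domain (curve p) Omega.
Hypothesis ab0 : 0 < det2 a b.
Hypothesis tiles :
  forall s x, exists i, triangle (tau i) = triangle (ltile o a b s x).
Hypothesis latt :
  forall i, exists s x, triangle (tau i) = triangle (ltile o a b s x).
Hypothesis heightE : forall n k,
  det2 (v n) (tau (c n) k - p n) = H (tau (c n) k).
Hypothesis arcs : forall s, is_sign s -> exists (tl : lat -> R) (lo a1 a2 a3 hi : R),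
  angle_lift tl lo a1 a2 a3 /\
  forall z, (tl z <= hi) = (0 <= s * H (Pt o a b z)) :> bool.
Implicit Types (i j : I) (k l : 'I_3) (n : nat) (x y : 'rV[R]_2) (z w : lat).

Let tiling : triangle_tiling tau. Proof. by case: ptau. Qed.
Let e2e : edge_to_edge tau. Proof. by case: ptau. Qed.
Let nd i : area (tau i) != 0. Proof. exact: tile_area. Qed.
Let openO : open Omega. Proof. by case: enc. Qed.
Let P := Pt o a b.
Let P_inj : injective P. Proof. exact: Pt_inj. Qed.

Lemma sign_opp (s : R) : is_sign s -> is_sign (- s).
Proof. by case=> ->; [right|left]; rewrite ?opprK. Qed.

Lemma sign_neq0 (s : R) : is_sign s -> s != 0.
Proof. by case=> ->; rewrite ?oppr_eq0 oner_eq0. Qed.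

Lemma sign_cases (s t : R) : is_sign s -> is_sign t -> t = s \/ t = - s.
Proof. by case=> ->; case=> ->; rewrite ?opprK; tauto. Qed.

Lemma tile_vertices i : exists f : 'I_3 -> lat,
  (forall k, tau i k = P (f k)) /\ (forall k l, k != l -> adj (f k) (f l)).
Proof.
have [s [x [pi [inj piE]]]] := tile_labels ptau ab0 latt i.
exists (fun k => x + sgl s (off (pi k))); split=> // k l kl.
by apply: adj_off; apply: contraNneq kl => /inj ->.
Qed.

Lemma adj_of_tile i k l z w : k != l -> tau i k = P z -> tau i l = P w -> adj z w.
Proof.
move=> kl; have [f [fE fa]] := tile_vertices i.
by rewrite !fE => /P_inj <- /P_inj <-; exact: fa.
Qed.

Lemma edge_tile z w : adj z w -> exists i k,
  (tau i k = P z /\ tau i (k + 1) = P w) \/ (tau i k = P w /\ tau i (k + 1) = P z).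
Proof.
move=> /adj_side[s [x [k [l [kl zE wE]]]]]; have [i e] := tiles s x.
have [m h] := eq_tile_pair ptau (ltile_area0 o ab0 s x) e kl.
by exists i, m; move: h; rewrite /ltile -zE -wE.
Qed.

Lemma ltile_vertex z : exists i k, tau i k = P z.
Proof.
have /edge_tile[i [k [[h _]|[_ h]]]] : adj z (z + e1) by rewrite adjD.
  by exists i, k.
by exists i, (k + 1).
Qed.

Lemma vertex_triangle i k : triangle (tau i) (tau i k).
Proof. exact: triangle_vertex. Qed.

Lemma side_triangle i k y : side (tau i) k y -> triangle (tau i) y.
Proof. by move=> [r /= r01 <-]; apply: triangle_convex => //; exact: vertex_triangle. Qed.

(** The common point lies on the chord of a tile; since the tiling is edge to
    edge, the edge is a side of this tile, and the curve crosses it there. *)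
Lemma edge_crossing z w y : adj z w -> segment (P z) (P w) y -> curve p y ->
  exists n t, [/\ is_sign t, halftile tau H t (c n) (P z)
    & halftile tau H (- t) (c n) (P w)].
Proof.
move=> zw sy cy; have [j [k0 jE]] := edge_tile zw.
have sj : side (tau j) k0 = segment (P z) (P w).
  by rewrite /side; case: jE => -[-> ->] //; rewrite segmentC.
have [n _ sn] := cy; have yc := chord_in_tile ptau traj sn.
suff [k [kE sk]] : exists k, ((tau (c n) k = P z /\ tau (c n) (k + 1) = P w) \/
    (tau (c n) k = P w /\ tau (c n) (k + 1) = P z)) /\ side (tau (c n)) k y.
  have hz (t : R) m : 0 < t * H (tau (c n) m) -> halftile tau H t (c n) (tau (c n) m).
    by move=> h; split; [exact: vertex_triangle|rewrite (fheight_vertex _ ptau)].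
  exists n; have := curve_side_sign ptau traj heightE sk cy.
  case: kE => -[<- <-] [] /andP[h1 h2].
  - exists (-1); split; [by right|apply: hz|apply: hz];
      by rewrite ?opprK ?mulN1r ?mul1r ?oppr_gt0.
  - exists 1; split; [by left|apply: hz|apply: hz];
      by rewrite ?opprK ?mulN1r ?mul1r ?oppr_gt0.
  - exists 1; split; [by left|apply: hz|apply: hz];
      by rewrite ?opprK ?mulN1r ?mul1r ?oppr_gt0.
  - exists (-1); split; [by right|apply: hz|apply: hz];
      by rewrite ?opprK ?mulN1r ?mul1r ?oppr_gt0.
rewrite -sj in sy.
have [jc|jc] := pselect (j = c n); first by exists k0; rewrite -jc.
have yj := side_triangle sy.
have yjc : (triangle (tau j) `&` triangle (tau (c n))) y by [].
have vx i k : y <> tau i k.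
  by move=> h; apply: (vertex_off_curve traj (i := i) (k := k)); rewrite -h.
case: (e2e jc) => [e|[k [l [_ e]]]|[k [l [sE e]]]].
- by rewrite e in yjc.
- by move: yjc; rewrite e => /vx.
move: yjc; rewrite e => sy'.
have kk : k = k0.
  apply/eqP; apply: contraT => kk; exfalso.
  have h1 := side_bar (nd j) sy; have h2 := side_bar (nd j) sy'.
  have := bar_sum y (nd j); have := bar_comb y (nd j).
  move: h1 h2 kk; case: (I3P k0) => ->; case: (I3P k) => ->; rewrite ?I3E ?eqxx //=;
    move=> -> -> _ yE; rewrite !(add0r, addr0) => h; move: yE; rewrite h;
    rewrite !(scale0r, scale1r, add0r, addr0); exact: vx.
have ll : tau (c n) l != tau (c n) (l + 1).
  by apply/eqP => /(vertex_inj (nd _)); case: (I3P l) => ->.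
have seg : segment (tau (c n) l) (tau (c n) (l + 1)) = segment (P z) (P w).
  by rewrite -sj -kk -/(side _ _) -sE.
exists l; split; first by have [[-> ->]|[-> ->]] := segment_eq_ends ll seg; tauto.
by rewrite -sE.
Qed.

Lemma lattice_points_finite : exists W : seq lat, forall z, z \in W <-> Omega (P z).
Proof.
have [_ _ _ [M [_ hM]] _] := enc.
have co y (r : 'I_2) : Omega y -> `|y 0 r| < M + 2.
  have M1 : M < M + 1 by lra.
  move=> Oy; have /(_ y Oy) := hM _ M1; rewrite /= => yM.
  have : ball (0 : 'rV[R]_2) (M + 2) y.
    by rewrite -ball_normE /= sub0r normrN; apply: le_lt_trans yM _; lra.
  by case=> _ /(_ 0 r); rewrite /ball /= mxE sub0r normrN.
pose C := ((M + 2 + `|o 0 0|) * (`|b 0 1| + `|a 0 1|)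
  + (M + 2 + `|o 0 1|) * (`|b 0 0| + `|a 0 0|)) / det2 a b.
have C0 y : Omega y -> `|cx o a b y| <= C /\ `|cy o a b y| <= C.
  move=> Oy; have h0 := co y 0 Oy; have h1 := co y 1 Oy.
  have g0 : `|y 0 0 - o 0 0| <= M + 2 + `|o 0 0|.
    by apply: (le_trans (ler_normB _ _)); rewrite lerD2r ltW.
  have g1 : `|y 0 1 - o 0 1| <= M + 2 + `|o 0 1|.
    by apply: (le_trans (ler_normB _ _)); rewrite lerD2r ltW.
  rewrite /cx /cy !normrM normfV (gtr0_norm ab0) /C !ler_pM2r ?invr_gt0 //.
  have n0 := normr_ge0 (y 0 0 - o 0 0); have n1 := normr_ge0 (y 0 1 - o 0 1).
  split; rewrite /det2 !mxE; apply: (le_trans (ler_normB _ _)); rewrite !normrM.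
    by apply: lerD; apply: ler_pM; rewrite ?normr_ge0 ?lerDl ?lerDr.
  rewrite [leLHS]addrC [`|a 0 1| * _]mulrC [`|a 0 0| * _]mulrC.
  by apply: lerD; apply: ler_pM; rewrite ?normr_ge0 ?lerDl ?lerDr.
have [N CN] : exists N : nat, C < N%:R.
  exists (Num.bound `|C|); apply: le_lt_trans (ler_norm _) _.
  by apply: archi_boundP; exact: normr_ge0.
pose ints : seq int := [seq (r%:Z - N%:Z)%R | r : nat <- iota 0 N.*2.+1].
have intsP (m : int) : `|m%:~R : R| <= C -> m \in ints.
  rewrite -intr_norm => h; have : `|m| < N%:Z.
    by rewrite -(ltr_int R); exact: le_lt_trans h CN.
  move=> mN; apply/mapP; exists (absz (m + N%:Z)); first by rewrite mem_iota; lia.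
  by lia.
exists [seq z <- [seq (m1, m2) | m1 : int <- ints, m2 : int <- ints] | `[<Omega (P z)>]] => z.
rewrite mem_filter; split; first by case/andP => /asboolP.
move=> Oz; apply/andP; split; first exact/asboolP.
have [h1 h2] := C0 _ Oz; move: h1 h2; rewrite cx_Pt // cy_Pt // => h1 h2.
by case: z Oz h1 h2 => m n _ h1 h2; apply: allpairs_f; exact: intsP.
Qed.

Section Inside.
Variables (W : seq lat) (s : R).
Hypothesis WE : forall z, z \in W <-> Omega (P z).
Hypothesis sg : is_sign s.
Hypothesis ins : inner tau c Omega H s 0.

Let innerE' t n := innerE ptau traj enc heightE n (s := t).

Lemma inner_nonempty : exists z, z \in W.
Proof.
have [k Ok] := inner_vertex ptau traj enc heightE sg ins.
have [f [fE _]] := tile_vertices (c 0%N).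
by exists (f k); apply/WE; rewrite -fE.
Qed.

Lemma edge_leaves z w : z \in W -> adj z w -> w \notin W ->
  exists n t, [/\ is_sign t, halftile tau H t (c n) (P z)
    & halftile tau H (- t) (c n) (P w)].
Proof.
move=> /WE Oz zw wW.
have [y sy cy] : exists2 y, segment (P z) (P w) y & curve p y.
  apply: contrapT => h; move/negP: wW; apply; apply/WE.
  apply: (segment_in_domain enc Oz) => y sy cy; apply: h; by exists y.
exact: edge_crossing zw sy cy.
Qed.

(** If the domain lay on both sides of the curve, no edge would leave the
    finite set of inner vertices. *)
Lemma outer_side : ~ inner tau c Omega H (- s) 0.
Proof.
move=> outs; have [z0 z0W] := inner_nonempty.
apply: (@no_drift _ (fun z : lat => z.1) _ _ z0W) => z zW.
exists (z + e1); last by rewrite /=; lia.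
apply: contraT => wW; exfalso.
have zw : adj z (z + e1) by rewrite adjD.
have [n [t [tg _ hw]]] := edge_leaves zW zw wW.
have tn : inner tau c Omega H (- t) n.
  apply/(innerE' _ (sign_opp tg)).
  by have [->|->] := sign_cases sg (sign_opp tg).
have [y hy Oy] := tn; move/negP: wW; apply; apply/WE.
exact: (halftile_spread ptau traj enc heightE hy hw Oy).
Qed.

Lemma sign_inside n t y : is_sign t -> halftile tau H t (c n) y -> Omega y -> t = s.
Proof.
move=> tg hy Oy; have [//|ts] := sign_cases sg tg.
exfalso; apply: outer_side; rewrite -ts; apply/(innerE' n tg).
by exists y.
Qed.

Lemma vertex_sign n t z : halftile tau H t (c n) (P z) -> 0 < t * H (P z).
Proof.
have [i [k kE]] := ltile_vertex z; rewrite -kE => -[T h].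
by rewrite -(fheight_vertex H ptau) (fheight_agree H ptau (vertex_triangle _ _) T).
Qed.

Lemma inside_arc : exists (tl : lat -> R) (lo a1 a2 a3 hi : R),
  angle_lift tl lo a1 a2 a3 /\
  (forall z, (tl z <= hi) = (0 <= s * H (P z)) :> bool) /\
  forall z w, z \in W -> adj z w -> w \notin W -> low tl hi z /\ high tl hi w.
Proof.
have [tl [lo [a1 [a2 [a3 [hi [al tlE]]]]]]] := arcs sg.
exists tl, lo, a1, a2, a3, hi; split=> //; split=> // z w zW zw wW.
have [n [t [tg hz hw]]] := edge_leaves zW zw wW.
have ts : t = s by apply: sign_inside tg hz _; apply/WE.
have := vertex_sign hz; have := vertex_sign hw.
rewrite ts mulNr /high /low !tlE => h1 h2; split; first exact: ltW.
by rewrite -ltNge; lra.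
Qed.

Lemma inside_nonneg z : z \in W -> 0 <= s * H (P z).
Proof.
have [tl [lo [a1 [a2 [a3 [hi [al [tlE out]]]]]]]] := inside_arc.
by move=> /(no_hole al out); rewrite /low tlE.
Qed.

Lemma inside_acyclic (q : seq lat) : {subset q <= W} -> (2 < size q)%N -> ~ ucycle adj q.
Proof.
have [tl [lo [a1 [a2 [a3 [hi [al [tlE out]]]]]]]] := inside_arc.
exact: (no_cycle al out).
Qed.

(** A tile that the curve avoids would be contained in the domain together
    with its three vertices, which form a cycle of inner vertices. *)
Lemma tile_passed i : triangle (tau i) `&` Omega !=set0 ->
  passes_by (curve p) (triangle (tau i)).
Proof.
move=> [y [yi Oy]]; apply: contrapT => np.
have [y' Oy' yi'] := triangle_near_interior (nd i) yi (open_nbhs_nbhs (conj openO Oy)).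
have Ov k : Omega (tau i k).
  apply: (segment_in_domain enc Oy') => q [r /= /andP[r0 r1] <-] cq.
  have [r1'|r1'] := eqVneq r 1.
    apply: (vertex_off_curve traj (i := i) (k := k)).
    by move: cq; rewrite r1' subrr scale0r add0r scale1r.
  apply: np; exists ((1 - r) *: y' + r *: tau i k); split=> //.
  apply: bar_interior => // l; rewrite bar_aff bar_vertex //.
  apply: ltr_pwDl; last by rewrite mulr_ge0.
  apply: mulr_gt0; last exact: interior_bar.
  by rewrite subr_gt0 lt_neqAle r1'.
have [f [fE fa]] := tile_vertices i.
apply: (@inside_acyclic [:: f 0; f 1; f 2]) => //.
  by move=> z; rewrite !inE => /or3P[] /eqP->; apply/WE; rewrite -fE.
have ne k l : k != l -> f k != f l.
  by move=> kl; apply: contraTneq (fa _ _ kl) => ->; rewrite adj_irr.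
by rewrite /ucycle /= !fa //= !inE !negb_or !ne.
Qed.

(** The tile is crossed by the curve, whose other side contains no point of
    the domain; and a point of height 0 in the domain could be moved to that
    side. *)
Lemma tile_height_pos i y : triangle (tau i) y -> Omega y -> 0 < s * fheight tau H i y.
Proof.
move=> yi Oy.
have [q [[n _ qn] qi]] : passes_by (curve p) (triangle (tau i)).
  by apply: tile_passed; exists y.
have iE := tile_interior_inj tiling qi (chord_in_tile ptau traj qn).
subst i; have [//|h|h] := ltgtP 0 (s * fheight tau H (c n) y).
  have hh : halftile tau H (- s) (c n) y by split=> //; rewrite mulNr oppr_gt0.
  have := sign_inside (sign_opp sg) hh Oy => e; move: h.
  have -> : s = 0 by lra.
  by rewrite mul0r ltxx.
have [k [[kT hk] _]] := shared_vertex ptau traj heightE n (sign_opp sg).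
have [e e0 he] := open_dir (tau (c n) k - y) (open_nbhs_nbhs (conj openO Oy)).
pose r := Num.min (e / 2) (1 / 2).
have [r0 re r1] : [/\ 0 < r, r < e & r < 1].
  by rewrite /r; case: (ltP (e / 2) (1 / 2)) => ?; split; lra.
have hh : halftile tau H (- s) (c n) ((1 - r) *: y + r *: tau (c n) k).
  split; first by apply: triangle_convex => //; rewrite !ltW.
  rewrite fheight_aff mulrDr [- s * (_ * fheight _ _ _ y)]mulrCA [- s * fheight _ _ _ y]mulNr -h.
  by rewrite oppr0 mulr0 add0r mulrCA mulr_gt0.
have /sign_inside : Omega ((1 - r) *: y + r *: tau (c n) k).
  have /he : 0 <= r < e by rewrite ltW.
  by congr Omega; apply: rv2P; rewrite !mxE; ring.
move=> /(_ n (- s) (sign_opp sg) hh) e'.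
have s0 : s = 0 by lra.
by have := sign_neq0 sg; rewrite s0 eqxx.
Qed.

(** * The inner vertices form a connected graph *)

Definition star z : set 'rV[R]_2 :=
  [set y | exists i k, triangle (tau i) y /\ tau i k = P z].

Lemma closed_stars (S : lat -> Prop) :
  closed [set y | exists z, [/\ z \in W, S z & star z y]].
Proof.
pose D := [set q : lat * (bool * 'I_3) | q.1 \in W /\ S q.1].
pose F q := triangle (ltile o a b q.2.1 (q.1 - sgl q.2.1 (off q.2.2))).
have -> : [set y | exists z, [/\ z \in W, S z & star z y]] = \bigcup_(q in D) F q.
  apply/seteqP; split=> y.
    move=> [z [zW Sz [i [k [yi kE]]]]].
    have [s' [x [pi [_ piE]]]] := tile_labels ptau ab0 latt i.
    have [s'' [x'' e]] := latt i.
    have [l lE] := triangle_eq_vertex k (nd i) (ltile_area0 o ab0 s'' x'') e.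
    exists (z, (s'', l)) => //; rewrite /F /=.
    have -> : z = x'' + sgl s'' (off l) by apply: P_inj; rewrite -kE lE.
    by rewrite addrK -e.
  move=> [[z [s' k]] [/= zW Sz]]; rewrite /F /= => yF; exists z; split=> //.
  have [i e] := tiles s' (z - sgl s' (off k)).
  have nd' := ltile_area0 o ab0 s' (z - sgl s' (off k)).
  have [l lE] := triangle_eq_vertex k nd' (nd i) (esym e).
  by exists i, l; rewrite e -lE /ltile subrK.
apply: closed_bigcup => [|q _]; last exact: closed_triangle (ltile_area0 _ _ _ _).
apply: (@sub_finite_set _ _ ([set` W] `*` [set: bool * 'I_3])).
  by move=> [z q] [/= zW _].
by apply: finite_setX; [exact: finite_seq|exact: finite_finset].
Qed.

Lemma tile_inner_vertex i k y : triangle (tau i) y -> Omega y ->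
  0 < s * H (tau i k) -> exists2 z, z \in W & tau i k = P z.
Proof.
move=> yi Oy hk; have hy := tile_height_pos yi Oy.
have [f [fE _]] := tile_vertices i; exists (f k) => //; apply/WE; rewrite -fE.
apply: (halftile_spread ptau traj enc heightE (conj yi hy) _ Oy).
by split; [exact: vertex_triangle|rewrite (fheight_vertex H ptau)].
Qed.

Lemma domain_star y : Omega y -> exists z, z \in W /\ star z y.
Proof.
move=> Oy; have [_ _ cov _] := tiling; have [i yi] := cov y.
have [k hk] : exists k, 0 < s * H (tau i k).
  apply: contrapT => nex; have := tile_height_pos yi Oy.
  rewrite /fheight mulr_sumr ltNge => /negP; apply; apply: sumr_le0 => k _.
  rewrite mulrCA; apply: mulr_ge0_le0; first by move/(triangleP _ (nd i)): yi; apply.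
  by rewrite leNgt; apply/negP => h; apply: nex; exists k.
have [z zW zE] := tile_inner_vertex yi Oy hk.
by exists z; split=> //; exists i, k.
Qed.

Lemma same_tile (S : lat -> Prop) i k l z w :
  closed_in (fun z => z \in W) S -> z \in W -> w \in W ->
  tau i k = P z -> tau i l = P w -> S z -> S w.
Proof.
move=> cS zW wW kE lE; have [kl|kl] := eqVneq k l.
  by rewrite (_ : z = w) //; apply: P_inj; rewrite -kE -lE kl.
by apply: cS => //; exact: adj_of_tile kl kE lE.
Qed.

(** The intersection of two tiles is a vertex or a side, and where the folded
    height is positive on a side one of the ends of the side is an inner
    vertex. *)
Lemma star_meet (S : lat -> Prop) z w y : closed_in (fun z => z \in W) S ->
  z \in W -> w \in W -> Omega y -> star z y -> star w y -> S z -> S w.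
Proof.
move=> cS zW wW Oy [i [k [yi kE]]] [j [l [yj lE]]].
have [ij|ij] := pselect (i = j).
  by rewrite -ij in lE; exact: same_tile kE lE.
have yij : (triangle (tau i) `&` triangle (tau j)) y by [].
have via m m' : tau i m = tau j m' -> 0 < s * H (tau i m) -> S z -> S w.
  move=> mE hm; have [u uW uE] := tile_inner_vertex yi Oy hm.
  move=> Sz; have Su : S u by exact: same_tile kE uE Sz.
  by rewrite mE in uE; exact: same_tile uE lE Su.
have hy := tile_height_pos yi Oy.
case: (e2e ij) => [e|[m [m' [mE e]]]|[m [m' [sE e]]]].
- by rewrite e in yij.
- move: yij; rewrite e => yE; apply: (via m m' mE).
  by rewrite -(fheight_vertex H ptau) -yE.
move: yij; rewrite e => sy.
have mm : tau i m != tau i (m + 1).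
  by apply/eqP => /(vertex_inj (nd i)); case: (I3P m) => ->.
have [h|h] : 0 < s * H (tau i m) \/ 0 < s * H (tau i (m + 1)).
  apply: contrapT => nex; move: hy; case: sy => r /= r01 <-.
  rewrite fheight_aff !(fheight_vertex H ptau) => hy.
  have h1 : s * H (tau i m) <= 0 by rewrite leNgt; apply/negP; tauto.
  have h2 : s * H (tau i (m + 1)) <= 0 by rewrite leNgt; apply/negP; tauto.
  case/andP: r01 => r0 r1; have g1 := mulr_ge0_le0 r0 h2.
  have g0 : 0 <= 1 - r by rewrite subr_ge0.
  have g2 := mulr_ge0_le0 g0 h1.
  move: hy; have -> : s * ((1 - r) * H (tau i m) + r * H (tau i (m + 1))) =
    (1 - r) * (s * H (tau i m)) + r * (s * H (tau i (m + 1))) by ring.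
  by rewrite ltNge => /negP; apply; rewrite -[0]addr0 lerD.
- by have [[e1 _]|[e1 _]] := segment_eq_ends mm sE; exact: via e1 h.
- by have [[_ e1]|[_ e1]] := segment_eq_ends mm sE; exact: via e1 h.
Qed.

(** The stars of the vertices where [S] holds and those of the vertices where
    it fails are two closed sets that cover the domain and do not meet in it. *)
Lemma inside_connected : connected_in (fun z => z \in W).
Proof.
move=> S cS [z0 z0W Sz0] z zW.
have [_ con _ _ _] := enc.
pose U (S : lat -> Prop) : set 'rV[R]_2 :=
  [set y | exists z, [/\ z \in W, S z & star z y]].
have self w : star w (P w).
  by have [i [k kE]] := ltile_vertex w; exists i, k; rewrite -kE; split=> //; exact: vertex_triangle.
have dis y : Omega y -> U S y -> U (fun z => ~ S z) y -> False.
  move=> Oy [w [wW Sw wy]] [w' [w'W nSw' w'y]]; apply: nSw'.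
  exact: (star_meet cS wW w'W Oy wy w'y Sw).
have e : Omega `&` U S = Omega.
  apply: con.
  - exists (P z0); split; first exact/WE.
    by exists z0.
  - exists (~` U (fun z => ~ S z)).
      by apply: closed_openC; exact: closed_stars.
    apply/seteqP; split=> y [Oy yU]; split=> //.
      by move=> yU'; exact: dis yU yU'.
    have [w [wW wy]] := domain_star Oy; exists w; split=> //.
    by apply: contrapT => nS; apply: yU; exists w.
  - by exists (U S) => //; exact: closed_stars.
apply: contrapT => nS; have Oz : Omega (P z) by exact/WE.
have [_ Uz] : (Omega `&` U S) (P z) by rewrite e.
by apply: (dis (P z)) => //; exists z.
Qed.

Lemma tiling_edgeP x y : tiling_edge tau x y ->
  exists z w, [/\ x = P z, y = P w & adj z w].
Proof.
move=> /asboolP[i [k [l [kl -> ->]]]]; have [f [fE fa]] := tile_vertices i.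
by exists (f k), (f l); split; [exact: fE|exact: fE|exact: fa].
Qed.

Lemma inside_edge z w : z \in W -> w \in W -> adj z w ->
  subgraph_edge tau Omega (P z) (P w).
Proof.
move=> zW wW zw; apply/andP; split; apply/asboolP.
  have [i [k [[h1 h2]|[h1 h2]]]] := edge_tile zw.
    by exists i, k, (k + 1); split=> //; case: (I3P k) => ->.
  by exists i, (k + 1), k; split=> //; case: (I3P k) => ->.
move=> y [r /= /andP[r0 r1] <-].
have Oz : Omega (P z) by apply/WE.
apply: (segment_in_domain enc Oz) => q [r' /= /andP[r0' r1'] qE] cq.
have sq : segment (P z) (P w) q.
  exists (r' * r); first by rewrite /=; apply/andP; split; nra.
  by rewrite -qE; apply: rv2P; rewrite !mxE; ring.
have [n [t [tg hz hw]]] := edge_crossing zw sq cq.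
have ts := sign_inside tg hz Oz.
have := vertex_sign hw; have := inside_nonneg wW; rewrite ts mulNr; lra.
Qed.

Lemma inside_tree : is_tree (subgraph_vertex tau Omega) (subgraph_edge tau Omega).
Proof.
have vP x : subgraph_vertex tau Omega x <-> exists2 z, z \in W & x = P z.
  split=> [[[i [k ->]] Ox]|[z zW ->]].
    have [f [fE _]] := tile_vertices i; exists (f k); last exact: fE.
    by apply/WE; rewrite -fE.
  split; last exact/WE.
  by have [i [k kE]] := ltile_vertex z; exists i, k.
split.
- by have [z zW] := inner_nonempty; exists (P z); apply/vP; exists z.
- move=> _ _ /vP[z zW ->] /vP[w wW ->].
  pose S u := exists2 q, path (subgraph_edge tau Omega) (P z) q & last (P z) q = P u.
  apply: (inside_connected (S := S)) => //; last by exists z => //; exists [::].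
  move=> u u' uW u'W uu' [q qp ql]; exists (rcons q (P u')).
    by rewrite rcons_path qp ql inside_edge.
  by rewrite last_rcons.
move=> q sz uq; have /andP[cq uniq_q] := uq.
have inv x : x \in q -> exists2 z, z \in W & x = P z.
  move=> xq; have /andP[/tiling_edgeP[z [w [xE _ _]]] /asboolP sub] := next_cycle cq xq.
  exists z => //; apply/WE; rewrite -xE; apply: sub; exact: segment_l.
have [q' q'E] : exists q', q = map P q'.
  elim: q inv {sz uq cq uniq_q} => [|x q IH] inv; first by exists [::].
  have [z _ xE] := inv x (mem_head _ _).
  have [q' q'E] := IH (fun y yq => inv y (mem_behead (s := x :: q) yq)).
  by exists (z :: q'); rewrite /= -xE -q'E.
apply: (@inside_acyclic q').
- move=> z zq; have [|w wW /P_inj ->] := inv (P z); last by [].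
  by rewrite q'E mem_map.
- by move: sz; rewrite q'E size_map.
rewrite /ucycle -(map_inj_uniq P_inj) -q'E uniq_q andbT.
move: cq; rewrite q'E cycle_map; apply: sub_cycle => z w /= /andP[/tiling_edgeP].
by move=> [z' [w' [/P_inj -> /P_inj ->]]].
Qed.

End Inside.
End Enclosed.

(** * The theorem *)

(** A wave that takes both signs has [-1 < - D / K < 1], and [rho] is the arc
    cosine of this quotient. *)
Lemma wave_arcs_pos (R : realType) (a1 a2 a3 K D th : R) z1 z2 :
  [/\ 0 < a1, 0 < a2 & 0 < a3] -> a1 + a2 + a3 = 2 * pi -> 0 < K ->
  K * cos (wangle a1 a3 th z1) + D < 0 < K * cos (wangle a1 a3 th z2) + D ->
  exists (tl : lat -> R) (lo b1 b2 b3 hi : R), angle_lift tl lo b1 b2 b3 /\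
    forall z, (tl z <= hi) = (0 <= K * cos (wangle a1 a3 th z) + D) :> bool.
Proof.
move=> pos sm K0 /andP[neg ps].
have c1 : - K <= K * cos (wangle a1 a3 th z1).
  by rewrite -mulrN1 ler_pM2l // cos_geN1.
have c2 : K * cos (wangle a1 a3 th z2) <= K.
  by rewrite -[leRHS]mulr1 ler_pM2l // cos_le1.
have dk : -1 < - D / K < 1.
  by rewrite ltr_pdivlMr // ltr_pdivrMr // mulN1r mul1r; apply/andP; split; lra.
have dk' : -1 <= - D / K <= 1 by case/andP: dk => *; rewrite !ltW.
pose rho := acos (- D / K).
have [_ cr] := acos_def dk'.
have rho0 : 0 < rho < pi.
  by case/andP: dk => d1 d2; rewrite acos_gt0 ?acos_ltpi ?d1 ?d2 ?ltW.
have DE : D = - K * cos rho by rewrite /rho cr mulNr mulrC divfK ?opprK // gt_eqF.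
exists (wlift a1 a3 th rho), (- rho), a1, a2, a3, rho; split.
  exact: wlift_angle.
by move=> z; exact: wave_arc K0 rho0 DE.
Qed.

Theorem theorem3 (R : realType) (I : Type) (tau : I -> 'I_3 -> 'rV[R]_2)
    (c : nat -> I) (p v : nat -> 'rV[R]_2) (Omega : set 'rV[R]_2) :
  periodic_triangle_tiling tau ->
  periodic_trajectory tau c p v ->
  enclosed_domain (curve p) Omega ->
  is_tree (subgraph_vertex tau Omega) (subgraph_edge tau Omega) /\
  (forall i : I, triangle (tau i) `&` Omega !=set0 ->
     passes_by (curve p) (triangle (tau i))).
Proof.
move=> ptau [traj _] enc.
have [og [a [b [ab0 tiles latt]]]] := lattice_tiling ptau.
have [a1 [a2 [a3 ta]]] := tile_anglesP ab0.
have [K [D [th [K0 heightE]]]] := height_wave ptau traj ab0 latt ta.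
set H := wave og a b a1 a3 K D th in heightE.
have HE z : H (Pt og a b z) = K * cos (wangle a1 a3 th z) + D by exact: wave_Pt.
have [pos sm _] := ta.
have [z1 [z2 zz]] : exists z1 z2, H (Pt og a b z1) < 0 < H (Pt og a b z2).
  have [k [l [_ _ os _]]] := next_on_side traj 0.
  have [f [fE _]] := tile_vertices ptau ab0 latt (c 0%N).
  have cp : curve p (p 1%N) by exists 0%N => //; exact: segment_r.
  have := curve_side_sign ptau traj heightE (open_side_bar (ptile_area ptau _) os) cp.
  by rewrite !fE => -[] h; [exists (f k), (f (k + 1))|exists (f (k + 1)), (f k)].
have arcs s : is_sign s -> exists (tl : lat -> R) (lo b1 b2 b3 hi : R),
    angle_lift tl lo b1 b2 b3 /\
    forall z, (tl z <= hi) = (0 <= s * H (Pt og a b z)) :> bool.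
  case=> ->.
    move: zz; rewrite !HE => zz.
    have [tl [lo [b1 [b2 [b3 [hi [al tlE]]]]]]] := wave_arcs_pos pos sm K0 zz.
    by exists tl, lo, b1, b2, b3, hi; split=> // z; rewrite tlE mul1r HE.
  have flip z : - 1 * H (Pt og a b z) = K * cos (wangle a1 a3 (th + pi) z) - D.
    rewrite HE; have -> : wangle a1 a3 (th + pi) z = wangle a1 a3 th z + pi.
      by rewrite /wangle (addrAC th pi) (addrAC _ pi).
    by rewrite cosDpi; ring.
  have zz' : K * cos (wangle a1 a3 (th + pi) z2) - D < 0
      < K * cos (wangle a1 a3 (th + pi) z1) - D.
    by rewrite -!flip !mulN1r oppr_lt0 oppr_gt0 andbC.
  have [tl [lo [b1 [b2 [b3 [hi [al tlE]]]]]]] := wave_arcs_pos pos sm K0 zz'.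
  by exists tl, lo, b1, b2, b3, hi; split=> // z; rewrite tlE flip.
have [W WE] := lattice_points_finite og enc ab0.
have [s sg ins] := ex_inner ptau traj enc heightE.
split; first exact: (inside_tree ptau traj enc ab0 tiles latt heightE arcs WE sg ins).
exact: (tile_passed ptau traj enc ab0 tiles latt heightE arcs WE sg ins).
Qed.
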